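(* Let $N\ge 1$, let $C_N=\{0,1,\ldots,N\}^3$ and let $\mathcal{C}_N=[0,N]^3$ be the real cube, with boundary $\partial\mathcal{C}_N$. Let $f$ be the triangle with vertices $(0,0,0),(1,0,0),(1,0,1)$ and $f'$ the triangle with vertices $(N,N,N),(N,N-1,N),(N,N-1,N-1)$. Let $\gamma$ be any piecewise affine curve (non-self-intersecting, as is implicit in speaking of the knot it closes up) that remains in $\partial\mathcal{C}_N$ and joins the centres of $f$ and $f'$. Then a 3-colour percolation model with Dobrushin boundary condition on $C_N$ defines a random knot $K$ as the equivalence class of the curve $\Gamma$ closed with the curve $\gamma$ that joins its extremities, where $\Gamma$ is the unique 3-colour line joining the centres of $f$ and $f'$; the construction of $K$ does not depend on the particular choice of $\gamma$.
   Context: Geometry. For integers $0\le k_1,k_2,k_3<N$ and a permutation $\rho$ of $\{1,2,3\}$, let $$t_\rho(k_1,k_2,k_3)=\{(k_1+x_1,k_2+x_2,k_3+x_3):\ (x_1,x_2,x_3)\in[0,1]^3,\ 0\le x_{\rho(1)}\le x_{\rho(2)}\le x_{\rho(3)}\le 1\}.$$ These tetrahedra divide the real cube $[0,N]^3$ (six for each unit cube), and their vertices are the points of $C_N$. The faces (resp. edges, vertices) of a tetrahedron are the subsets obtained by replacing one (resp. two, three) of the four inequalities by equalities. Dobrushin boundary condition. Let $F^{(i)}_k$ be the strict face of the cube on which the $i$-th coordinate equals $k$ (the other two coordinates lie in $\{1,\dots,N-1\}$), and $E^{(i,j)}_{k,l}$ the strict edge of the cube on which the $i$-th coordinate equals $k$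 and the $j$-th coordinate equals $l$ (the remaining coordinate lies in $\{1,\dots,N-1\}$). A 3-colour percolation model with Dobrushin boundary condition on $C_N$ is a family of independent random variables $(U_x)_{x\in C_N}$ with values in $\{0,1,2\}$ (the colours) such that: - for $x\in\{1,\ldots,N-1\}^3$, $U_x$ is uniform on $\{0,1,2\}$; - $U_x=0$ a.s. for $x\in\{(0,0,0),(0,N,0),(0,0,N),(N,N,0),(0,N,N),(N,N,N)\}\cup F^{(1)}_0\cup F^{(2)}_N\cup E^{(2,3)}_{N,0}\cup E^{(2,3)}_{N,N}\cup E^{(1,3)}_{0,N}\cup E^{(1,2)}_{0,0}\cup E^{(1,2)}_{0,N}\cup E^{(1,2)}_{N,N}$; - $U_x=1$ a.s. for $x\in\{(N,0,N)\}\cup F^{(2)}_0\cup F^{(3)}_N\cup E^{(2,3)}_{0,N}\cup E^{(1,3)}_{N,N}$; - $U_x=2$ a.s. for $x\in\{(N,0,0)\}\cup F^{(1)}_N\cup F^{(3)}_0\cup E^{(2,3)}_{0,0}\cup E^{(1,3)}_{0,0}\cup E^{(1,3)}_{N,0}\cup E^{(1,2)}_{N,0}$. The triangles $f$ and $f'$ are the only two faces of tetrahedra lying on the boundary of the cube whose vertices carry all three colours. 3-colour lines. If the vertices of a tetrahedron carry all three colours, then one colour appears twice and each of the other two once, and exactly two of its faces carry three colours; the segment joining the centres of these two faces is an element of a 3-colour line. These segments fit together into the 3-colour lines, which are non-intersecting and non-self-intersecting curves, each being either a loop or a curve with extremities on the boundary of the cube. With the Dobrushin boundary condition there is a unique 3-colour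 line joining the centres of $f$ and $f'$; it is a random non-self-intersecting piecewise affine curve $\Gamma:[0,L_N]\to\mathcal{C}_N$ made of $L_N$ segments. Knots. Two non-self-intersecting continuous loops $\gamma_0,\gamma_1:[0,1]\to\mathbb{R}^3$ (with $\gamma_i(0)=\gamma_i(1)$) are equivalent if there exists a continuous function $h:[0,1]\times[0,1]\to\mathbb{R}^3$ such that $h(t,0)=\gamma_0(t)$, $h(t,1)=\gamma_1(t)$ and, for any $s\in[0,1]$, the map $t\mapsto h(t,s)$ is injective except that $h(0,s)=h(1,s)$. An equivalence class is called a knot. *)

(* Defs.v *)
From HB Require Import structures.
From mathcomp Require Import all_boot all_order all_fingroup all_algebra.
From mathcomp Require Import all_classical all_reals all_analysis.
Import Order.TTheory GRing.Theory Num.Theory.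
Import numFieldNormedType.Exports.

Set Implicit Arguments.
Unset Strict Implicit.
Unset Printing Implicit Defensive.

Local Open Scope classical_set_scope.
Local Open Scope ring_scope.

(* ** Sites, unit cubes and the Kuhn tetrahedra *)

(* Axes and colours are numbered 0, 1, 2. *)
Notation axis := 'I_3 (only parsing).
Notation colour := 'I_3 (only parsing).

(* A point of C_N = {0, ..., N}^3. *)
Notation site N := {ffun axis -> 'I_N.+1}.
(* A unit cube of [0, N]^3, given by its lowest corner (k_1, k_2, k_3),
   0 <= k_i < N. *)
Notation cell N := {ffun axis -> 'I_N}.

Definition mksite (N a b c : nat) : site N :=
  [ffun i : axis => inord (nth 0%N [:: a; b; c] i)].

Section Geometry.
Context {R : realType}.
Implicit Types (N : nat) (rho : 'S_3).

Definition pt n (x : {ffun axis -> 'I_n}) : 'rV[R]_3 := \row_i (x i : nat)%:R.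

(* The chain 0 <= x_{rho(1)} <= x_{rho(2)} <= x_{rho(3)} <= 1; its m-th
   inequality (0 <= m < 4) compares the entries m and m + 1. *)
Definition chain rho (x : 'rV[R]_3) : seq R :=
  0 :: rcons [seq x ord0 (rho i) | i <- enum 'I_3] 1.

(* The part of the tetrahedron t_rho(k) obtained by replacing the inequalities
   with index in E by equalities: the tetrahedron itself if E is empty, one of
   its faces, edges or vertices if E has 1, 2 or 3 elements. *)
Definition tetra_part N (k : cell N) rho (E : {set 'I_4}) : set 'rV[R]_3 :=
  [set y | let c := chain rho (y - pt k) in
     forall m : 'I_4, c`_m <= c`_m.+1 /\ (m \in E -> c`_m = c`_m.+1)].

End Geometry.

(* The vertex of t_rho(k) at which all the inequalities of the chain but the
   j-th are equalities, i.e., x_{rho(i)} = 0 before position j of the chain and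
   1 after it; see tetra_part_vertex below. *)
Definition vertex N (k : cell N) (rho : 'S_3) (j : 'I_4) : site N :=
  [ffun i : axis => inord (k i + (j <= (rho^-1)%g i))%N].

(* The face of t_rho(k) on which the m-th inequality is an equality. *)
Definition face N (k : cell N) (rho : 'S_3) (m : 'I_4) : seq (site N) :=
  [seq vertex k rho j | j <- enum 'I_4 & j != m].

Section VertexTheory.
Context {R : realType} (N : nat) (k : cell N) (rho : 'S_3).

Lemma vertexE (j : 'I_4) (i : axis) :
  vertex k rho j (rho i) = (k (rho i) + (j <= i))%N :> nat.
Proof.
rewrite ffunE permK inordK // ltnS.
have := ltn_ord (k (rho i)).
by case: (j <= i)%N; rewrite ?addn1 ?addn0 // => /ltnW.
Qed.

Lemma pt_vertexE (j : 'I_4) (i : axis) :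
  (pt (vertex k rho j) - pt k : 'rV[R]_3) ord0 (rho i) = (j <= i)%:R.
Proof.
by rewrite mxE [X in _ + X]mxE ![pt _ _ _]mxE vertexE natrD addrAC subrr add0r.
Qed.

Lemma chainE (x : 'rV[R]_3) : chain rho x =
  [:: 0; x ord0 (rho ord0); x ord0 (rho (lift ord0 ord0));
      x ord0 (rho (lift ord0 (lift ord0 ord0))); 1].
Proof.
rewrite /chain 3!enum_ordSl.
have -> : enum 'I_0 = [::] by apply/size0nil; rewrite size_enum_ord.
by [].
Qed.

Lemma chain_vertex (j : 'I_4) (m : nat) : (m < 5)%N ->
  (chain rho (pt (vertex k rho j) - pt k : 'rV[R]_3))`_m = (j < m)%:R.
Proof.
by rewrite chainE !pt_vertexE; case: j m
  => [[|[|[|[|j]]]] lj] [|[|[|[|[|m]]]]] lm.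
Qed.

Lemma tetra_part_vertex (j : 'I_4) (E : {set 'I_4}) :
  tetra_part k rho E (pt (vertex k rho j) : 'rV[R]_3) <-> j \notin E.
Proof.
have lo (m : 'I_4) := chain_vertex j (leqW (ltn_ord m)).
have hi (m : 'I_4) : (chain rho (pt (vertex k rho j) - pt k : 'rV[R]_3))`_m.+1
    = (j <= m)%:R by rewrite chain_vertex // ltnS.
split=> [h|jE c m].
  apply/negP => jE; have [_ /(_ jE)] := h j.
  by rewrite lo hi ltnn leqnn => /esym/eqP; rewrite oner_eq0.
rewrite {}/c lo hi.
split; first by rewrite ler_nat; case: ltngtP.
move=> mE; have jm : j != m by apply: contraNneq jE => ->.
by rewrite (leq_eqVlt j) val_eqE (negPf jm).
Qed.

Lemma tetra_part_setC1 (j : 'I_4) :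
  tetra_part k rho [set~ j]%SET = [set (pt (vertex k rho j) : 'rV[R]_3)].
Proof.
apply/seteqP; split=> [y h|_ ->]; last first.
  by apply/tetra_part_vertex; rewrite !inE eqxx.
have hE (m : nat) (m4 : (m < 4)%N) : m != j ->
    (chain rho (y - pt k))`_m = (chain rho (y - pt k))`_m.+1.
  by move=> mj; apply: (h (Ordinal m4)).2; rewrite !inE -val_eqE.
have lo (m : nat) : (m <= j)%N -> (chain rho (y - pt k))`_m = 0.
  elim: m => [|m IH] mj; first by rewrite chainE.
  rewrite -hE; first exact: IH (ltnW mj).
    exact: ltn_trans mj (ltn_ord j).
  by rewrite ltn_eqF.
have hi (m : nat) : (m < 4 - j)%N -> (chain rho (y - pt k))`_(4 - m) = 1.
  elim: m => [|m IH] mj; first by rewrite chainE.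
  have m4 : (m < 4)%N by apply: leq_trans (ltnW mj) (leq_subr _ _).
  rewrite hE; first by rewrite subnSK // IH // ltnW.
    by rewrite ltn_subrL.
  by rewrite gtn_eqF // ltn_subRL addnC -ltn_subRL.
have chE (m : nat) : (m <= 4)%N -> (chain rho (y - pt k))`_m = (j < m)%:R.
  move=> m4; have [mj|jm] := leqP m j; first exact: lo.
  by rewrite -(subKn m4) hi // ltn_sub2l // (leq_trans jm).
apply/rowP => i; rewrite -[i](permKV rho); set a := (rho^-1)%g i.
apply: (addIr (- pt k ord0 (rho a))).
have <- (x : 'rV[R]_3) : (x - pt k) ord0 (rho a) = x ord0 (rho a) - pt k ord0 (rho a).
  by rewrite mxE [X in _ + X]mxE.
have <- (x : 'rV[R]_3) : (x - pt k) ord0 (rho a) = x ord0 (rho a) - pt k ord0 (rho a).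
  by rewrite mxE [X in _ + X]mxE.
rewrite pt_vertexE.
have -> : (y - pt k) ord0 (rho a) = (chain rho (y - pt k))`_a.+1.
  rewrite chainE; case: a => [[|[|[|a]]] la] //=;
    by congr (_ ord0 (rho _)); apply/val_inj.
by rewrite (chE _ (leqW (ltn_ord a))) ltnS.
Qed.

End VertexTheory.

(* ** Three-colour lines *)

Section Lines.
Context {R : realType} (N : nat).
Implicit Types (col : site N -> colour) (f : seq (site N)).

(* The centre of the triangle with vertices f (a sequence of three sites). *)
Definition centre f : 'rV[R]_3 := 3^-1 *: \sum_(v <- f) pt v.

Definition three_coloured col f : bool :=
  [forall c : colour, c \in map col f].

Definition three_colour_segment col (a b : 'rV[R]_3) : Prop :=
  exists (k : cell N) (rho : 'S_3) (m m' : 'I_4),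
    [/\ m != m', three_coloured col (face k rho m),
        three_coloured col (face k rho m'),
        a = centre (face k rho m) & b = centre (face k rho m')].

Definition cube : set 'rV[R]_3 :=
  [set x | forall i, 0 <= x ord0 i <= N%:R].

Definition cube_boundary : set 'rV[R]_3 := closure cube `\` interior cube.

(* A three-colour line is given by its successive nodes p_0, ..., p_L: its L
   segments are pairwise distinct, and it is complete, i.e., it is a loop or
   both its extremities are on the boundary of the cube. *)
Definition three_colour_line col (p : seq 'rV[R]_3) : Prop :=
  [/\ (1 < size p)%N,
      forall i, (i.+1 < size p)%N -> three_colour_segment col p`_i p`_i.+1,
      forall i j, (i < j)%N -> (j.+1 < size p)%N ->
        [set p`_i; p`_i.+1] <> [set p`_j; p`_j.+1]
    & head 0 p = last 0 p \/
      (cube_boundary (head 0 p) /\ cube_boundary (last 0 p))].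

Definition triangle_f : seq (site N) :=
  [:: mksite N 0 0 0; mksite N 1 0 0; mksite N 1 0 1].
Definition triangle_f' : seq (site N) :=
  [:: mksite N N N N; mksite N N N.-1 N; mksite N N N.-1 N.-1].

Definition line_from_f_to_f' col (p : seq 'rV[R]_3) : Prop :=
  [/\ three_colour_line col p, head 0 p = centre triangle_f
    & last 0 p = centre triangle_f'].

End Lines.

(* ** Curves and knots *)

Section Knots.
Context {R : realType}.
Implicit Types (g : R -> 'rV[R]_3) (p : seq 'rV[R]_3).

(* A curve parametrized by an interval is a function on the whole of R of which
   only the values on that interval matter. *)

(* The piecewise affine curve [0, L] -> R^3 with nodes p_0, ..., p_L, running
   through the i-th segment on [i, i + 1]. *)
Definition polygon p (t : R) : 'rV[R]_3 :=
  let i := Num.trunc t in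
  (1 - (t - i%:R)) *: p`_i + (t - i%:R) *: p`_i.+1.

Definition affine_on (a b : R) g : Prop :=
  forall s : R, s \in `[(0 : R), 1] ->
    g ((1 - s) * a + s * b) = (1 - s) *: g a + s *: g b.

Definition piecewise_affine g : Prop :=
  exists s : seq R, [/\ sorted <%R s, (1 < size s)%N,
    head 0 s = 0, last 0 s = 1
    & forall i, (i.+1 < size s)%N -> affine_on s`_i s`_i.+1 g].

(* The curves gamma on the boundary of the cube [0, N]^3. *)
Definition boundary_curve (N : nat) g : Prop :=
  [/\ piecewise_affine g, {in `[(0 : R), 1] &, injective g},
      forall t : R, t \in `[(0 : R), 1] -> cube_boundary N (g t),
      g 0 = centre (triangle_f N) & g 1 = centre (triangle_f' N)].

Definition continuous_loop g : Prop :=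
  {within `[(0 : R), 1], continuous g} /\ g 0 = g 1.

(* Injectivity on [0, 1[ and g 0 = g 1 leave no other coincidence on [0, 1]. *)
Definition simple_loop g : Prop :=
  continuous_loop g /\ {in `[(0 : R), 1[ &, injective g}.

Definition knot_equiv g0 g1 : Prop :=
  exists h : R * R -> 'rV[R]_3,
    [/\ {within `[(0 : R), 1] `*` `[(0 : R), 1], continuous h},
        forall t : R, t \in `[(0 : R), 1] -> h (t, 0) = g0 t,
        forall t : R, t \in `[(0 : R), 1] -> h (t, 1) = g1 t
      & forall s : R, s \in `[(0 : R), 1] ->
          h (0, s) = h (1, s) /\ {in `[(0 : R), 1[ &, injective (fun t => h (t, s))}].

Definition knot_class g : set (R -> 'rV[R]_3) :=
  [set g' | simple_loop g' /\ knot_equiv g g'].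

(* The curve Gamma of nodes p, followed by g run backwards. *)
Definition close_with p g (t : R) : 'rV[R]_3 :=
  if t <= 2^-1 then polygon p (2 * t * (size p).-1%:R) else g (2 - 2 * t).

End Knots.

Record knot (R : realType) := Knot {
  knot_set :> set (R -> 'rV[R]_3);
  knot_setP : exists2 g, simple_loop g & knot_set = knot_class g }.

(* ** The percolation model *)

Section BoundaryCondition.
Context (N : nat).
Implicit Types (x : site N) (i j : axis) (k l : nat).

Definition strictly_inside x i : bool := (0 < x i < N)%N.

Definition interior_site x : bool := [forall i, strictly_inside x i].

Definition on_face i k x : bool :=
  (x i == k :> nat) && [forall a, (a != i) ==> strictly_inside x a].

Definition on_edge i j k l x : bool :=
  [&& x i == k :> nat, x j == l :> nat
    & [forall a, [&& a != i & a != j] ==> strictly_inside x a]].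

End BoundaryCondition.

Definition axis1 : axis := inord 0.
Definition axis2 : axis := inord 1.
Definition axis3 : axis := inord 2.

(* The sites where the colour is prescribed to be 0, 1 and 2 respectively. *)

Definition boundary0 N (x : site N) : bool :=
  [|| x \in [:: mksite N 0 0 0; mksite N 0 N 0; mksite N 0 0 N;
                mksite N N N 0; mksite N 0 N N; mksite N N N N],
      on_face axis1 0 x, on_face axis2 N x,
      on_edge axis2 axis3 N 0 x, on_edge axis2 axis3 N N x,
      on_edge axis1 axis3 0 N x, on_edge axis1 axis2 0 0 x,
      on_edge axis1 axis2 0 N x | on_edge axis1 axis2 N N x].

Definition boundary1 N (x : site N) : bool :=
  [|| x == mksite N N 0 N, on_face axis2 0 x, on_face axis3 N x,
      on_edge axis2 axis3 0 N x | on_edge axis1 axis3 N N x].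

Definition boundary2 N (x : site N) : bool :=
  [|| x == mksite N N 0 0, on_face axis1 N x, on_face axis3 0 x,
      on_edge axis2 axis3 0 0 x, on_edge axis1 axis3 0 0 x,
      on_edge axis1 axis3 N 0 x | on_edge axis1 axis2 N 0 x].

Section Percolation.
Context {R : realType} {N : nat} {d : measure_display} {T : measurableType d}.
Context (P : probability T R) (U : site N -> T -> colour).

Definition mutually_independent : Prop :=
  forall (J : {set site N}) (B : site N -> set colour),
    P (\bigcap_(x in [set` J]) U x @^-1` B x)
    = (\prod_(x in J) P (U x @^-1` B x))%E.

Definition dobrushin_percolation : Prop :=
  [/\ forall x c, measurable (U x @^-1` [set c]),
      mutually_independent,
      forall x, interior_site x ->
        forall c, P (U x @^-1` [set c]) = (3^-1 : R)%:E
    & [/\ forall x, boundary0 x -> {ae P, forall w, U x w = inord 0},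
          forall x, boundary1 x -> {ae P, forall w, U x w = inord 1}
        & forall x, boundary2 x -> {ae P, forall w, U x w = inord 2}]].

(* Every set of knots counts as an event: K only depends on the finitely many
   colours. *)
Definition random_knot (K : T -> knot R) : Prop :=
  forall A : set (knot R), measurable (K @^-1` A).

End Percolation.

(* Main.v *)
(* A face of a tetrahedron is a flag (k, rho, m), and its centre determines it up to
   the reflection tau in the two tetrahedra that share it; sigma exchanges the two
   tricoloured faces of a tetrahedron.  Iterating tau \o sigma from f gives a cycle
   which tau reverses, so the line from f can only end at the other tricoloured face
   on the boundary, f'.  Closed with a curve on the boundary, this line is a simple
   loop that is affine on both sides of every point.

   The equivalence of loops is not required to extend to the ambient space, so such
   loops are all equivalent: cut the loop by a plane near the point that is farthest
   from its origin, and shrink the part below the plane by the Alexander trick.  What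
   is left is a planar quadrilateral.  Hence K is constant, whatever gamma is. *)
Require Import Defs.
From mathcomp Require Import all_boot all_order all_fingroup all_algebra.
From mathcomp Require Import all_classical all_reals all_analysis.
From mathcomp Require Import zify ring lra.
Import Order.TTheory GRing.Theory Num.Theory.
Import numFieldNormedType.Exports.
Set Implicit Arguments.
Unset Strict Implicit.
Unset Printing Implicit Defensive.
Local Open Scope classical_set_scope.
Local Open Scope ring_scope.

(** Three times the centre of a face is an integer vector, so the gluing of tetrahedra, the position
    on the boundary and the disjointness of open tetrahedra all become linear integer arithmetic on
    corners, ranks and indices. The farthest point matters because it is the strict maximum of a
    linear functional on the loop: a level just below the maximum meets the loop only in the two
    affine germs at that point. The rest of the loop is strictly below the level, and a homothety
    centred at the midpoint of the cut keeps it there, so it never meets the wedge above while it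
    shrinks. [knot_equiv] asks for joint continuity, and for injectivity at each time separately. At
    time 0 the shrunk part has collapsed to a point; a bounded deviation times a ratio tending to 0
    is still continuous there. Chance enters only through the almost sure boundary colours: the
    statements on lines and loops hold for every colouring that has them. *)

Lemma axis_ind (Q : 'I_3 -> Prop) : Q axis1 -> Q axis2 -> Q axis3 -> forall i, Q i.
Proof.
move=> Q1 Q2 Q3 [[|[|[|i]]] li] //.
- by rewrite (_ : Ordinal li = axis1) //; apply/val_inj; rewrite /= inordK.
- by rewrite (_ : Ordinal li = axis2) //; apply/val_inj; rewrite /= inordK.
- by rewrite (_ : Ordinal li = axis3) //; apply/val_inj; rewrite /= inordK.
Qed.

Lemma axis_eqE : ((axis1 == axis2) = false) * ((axis1 == axis3) = false) *
  ((axis2 == axis1) = false) * ((axis2 == axis3) = false) *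
  ((axis3 == axis1) = false) * ((axis3 == axis2) = false).
Proof. by do !split; rewrite -val_eqE /= !inordK. Qed.

(** * The real cube and its boundary *)

Section Cube.
Context {R : realType}.
Variable N : nat.
Implicit Types x : 'rV[R]_3.

Lemma cube_interior x : (forall i, 0 < x ord0 i < N%:R) -> interior (cube N) x.
Proof.
move=> xN; apply: (@filter_forall _ _ (fun i => [set y : 'rV[R]_3 | 0 <= y ord0 i <= N%:R]) (nbhs x)) => i.
have /andP[x0 x1] := xN i.
have : \forall y \near x, (y : 'rV[R]_3) ord0 i \in `]0, N%:R[.
  have /(_ `]0, N%:R[%classic) := @coord_continuous R 1 3 ord0 i x.
  by apply; apply: open_nbhs_nbhs; split; [exact: interval_open|rewrite /= in_itv /= x0].
by apply: filterS => y; rewrite in_itv /= => /andP[/ltW-> /ltW->].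
Qed.

Lemma cube_boundaryI x i : (forall a, 0 <= x ord0 a <= N%:R) ->
  x ord0 i = 0 \/ x ord0 i = N%:R -> cube_boundary N x.
Proof.
move=> xN xi; split; first exact: subset_closure.
move=> /nbhs_ballP[e /= e0 be].
(* If a ball around [x] were inside the cube, [x] could move by [e / 2] both ways along axis [i];
   one of the two moves leaves the cube. *)
have near_cube s : `|s| < e -> 0 <= x ord0 i + s <= N%:R.
  move=> se; have /be/(_ i) : ball x e (x + s *: delta_mx ord0 i).
    split=> [|a b] //; rewrite -ball_normE /ball_ /= !mxE opprD addrA subrr sub0r normrN normrM.
    by case: (_ && _); rewrite ?normr1 ?normr0 ?mulr1 ?mulr0.
  by rewrite !mxE !eqxx mulr1.
have e2 : `|e / 2| < e by rewrite gtr0_norm; lra.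
have e2' : `|- (e / 2)| < e by rewrite normrN.
have := near_cube _ e2; have := near_cube _ e2'.
by case: xi => ->; lra.
Qed.

Lemma cube_boundary_out x : cube_boundary N x -> exists i, ~~ (0 < x ord0 i < N%:R).
Proof.
move=> [_ nx]; apply: contrapT => no; apply: nx; apply: cube_interior => i.
by apply: contrapT => /negP xi; apply: no; exists i.
Qed.

End Cube.

(** * Curves that are affine on both sides of every point *)

Section LocallyAffine.
Context {R : realType}.
Implicit Types (g : R -> 'rV[R]_3) (t a b : R).

(** One-sided germs rather than a global subdivision: they survive gluing, reversal and change of
    speed without merging lists of break points, and the unknotting argument looks at germs only. *)
Definition ray_affine g t e := exists2 d : R, 0 < d &
  exists v, forall s, 0 <= s <= d -> g (t + s * e) = g t + s *: v.

Definition locally_affine g := (forall t, 0 <= t < 1 -> ray_affine g t 1) /\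
  (forall t, 0 < t <= 1 -> ray_affine g t (-1)).

Lemma ray_affine_scale g t e c : 0 < c -> ray_affine g t e -> ray_affine g t (c * e).
Proof.
move=> c0 [d d0 [v gv]]; exists (d / c); first exact: divr_gt0.
exists (c *: v) => s /andP[s0 sd]; rewrite mulrA gv ?scalerA //.
by rewrite mulr_ge0 ?(ltW c0) //= -ler_pdivlMr.
Qed.

(** Transfers a germ between curves that agree after an affine change of parameter; this is how each
    half of [close_with] is reduced to [polygon] or to the boundary curve. *)
Lemma ray_affine_eq f g t u e e' d : 0 < d ->
  (forall s, 0 <= s <= d -> g (t + s * e') = f (u + s * e)) ->
  ray_affine f u e -> ray_affine g t e'.
Proof.
move=> d0 gf [d' d'0 [v fv]]; exists (Num.min d d'); first by rewrite lt_min d0.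
have g0 : g t = f u by have := gf 0; rewrite lexx (ltW d0) !mul0r !addr0; apply.
exists v => s; rewrite le_min => /and3P[s0 sd sd'].
by rewrite gf ?s0 // fv ?s0 // g0.
Qed.

Definition affine_piece a b g :=
  exists u v, forall t, a <= t <= b -> g t = u + t *: v.

Lemma affine_piece_right a b g t : affine_piece a b g -> a <= t < b -> ray_affine g t 1.
Proof.
move=> [u [v guv]] /andP[a_t tb]; exists (b - t); first by rewrite subr_gt0.
exists v => s /andP[s0 sb]; rewrite mulr1 !guv ?scalerDl ?addrA //; last by lra.
by rewrite a_t ltW.
Qed.

Lemma affine_piece_left a b g t : affine_piece a b g -> a < t <= b -> ray_affine g t (-1).
Proof.
move=> [u [v guv]] /andP[a_t tb]; exists (t - a); first by rewrite subr_gt0.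
exists (- v) => s /andP[s0 sb]; rewrite mulrN1 !guv ?scalerBl ?scalerN ?addrA //; last by lra.
by rewrite tb ltW.
Qed.

Lemma affine_on_piece a b g : a < b -> affine_on a b g -> affine_piece a b g.
Proof.
move=> ab gab; exists (g a - (a / (b - a)) *: (g b - g a)), ((b - a)^-1 *: (g b - g a)) => t tab.
have b0 : b - a != 0 by rewrite subr_eq0 gt_eqF.
pose s := (t - a) / (b - a).
have tE : t = (1 - s) * a + s * b by rewrite /s; field.
have s01 : s \in `[(0 : R), 1].
  rewrite in_itv /= /s divr_ge0 ?subr_ge0 ?(ltW ab) //=; last by case/andP: tab.
  by rewrite ler_pdivrMr ?subr_gt0 // mul1r lerD2r; case/andP: tab.
have := gab s s01; rewrite -tE => ->; apply/rowP => i; rewrite !mxE /s; field.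
exact: b0.
Qed.

Lemma seq_bracket (s : seq R) (x t : R) : x <= t < last x s -> exists2 i : nat, (i < size s)%N &
  (x :: s)`_i <= t < (x :: s)`_i.+1.
Proof.
elim: s x => [|y s IH] x /= /andP[xt tl]; first by move: (le_lt_trans xt tl); rewrite ltxx.
have [ty|yt] := ltP t y; first by exists 0%N; rewrite //= xt.
by have [i iS Hi] := IH y ltac:(by rewrite yt tl); exists i.+1.
Qed.

Lemma seq_bracket_left (s : seq R) (x t : R) : x < t <= last x s -> exists2 i : nat, (i < size s)%N &
  (x :: s)`_i < t <= (x :: s)`_i.+1.
Proof.
elim: s x => [|y s IH] x /= /andP[xt tl]; first by move: (lt_le_trans xt tl); rewrite ltxx.
have [ty|yt] := leP t y; first by exists 0%N; rewrite //= xt.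
by have [i iS Hi] := IH y ltac:(by rewrite yt tl); exists i.+1.
Qed.

Lemma piecewise_affine_locally g : piecewise_affine g -> locally_affine g.
Proof.
move=> [[|x s] [_ //= _ -> s1 gs]]; split=> t t01.
  have [i iS /andP[lo hi]] := @seq_bracket s 0 t ltac:(by rewrite s1).
  apply: affine_piece_right ((0 :: s)`_i) ((0 :: s)`_i.+1) _ _ _ _; last by rewrite lo.
  exact: affine_on_piece (le_lt_trans lo hi) (gs i iS).
have [i iS /andP[lo hi]] := @seq_bracket_left s 0 t ltac:(by rewrite s1).
apply: affine_piece_left ((0 :: s)`_i) ((0 :: s)`_i.+1) _ _ _ _; last by rewrite lo.
exact: affine_on_piece (lt_le_trans lo hi) (gs i iS).
Qed.

(** The right end is included: there [polygon] already reads the next segment, but at its first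
    node. *)
Lemma polygonE (p : seq 'rV[R]_3) (i : nat) t : i%:R <= t <= i.+1%:R ->
  polygon p t = (1 - (t - i%:R)) *: p`_i + (t - i%:R) *: p`_i.+1.
Proof.
move=> /andP[it]; rewrite le_eqVlt => /orP[/eqP ->|ti]; last first.
  by rewrite /polygon (@truncn_def _ _ i) // it.
rewrite /polygon natrK subrr subr0 scale1r scale0r addr0.
have -> : i.+1%:R - i%:R = 1 :> R by rewrite -natr1; ring.
by rewrite subrr scale0r scale1r add0r.
Qed.

Lemma polygon_nat (p : seq 'rV[R]_3) (i : nat) : polygon p i%:R = p`_i.
Proof. by rewrite (@polygonE _ i) ?subrr ?subr0 ?scale1r ?scale0r ?addr0 // lexx ler_nat leqnSn. Qed.

Lemma polygon_piece (p : seq 'rV[R]_3) (i : nat) : affine_piece i%:R i.+1%:R (polygon p).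
Proof.
exists ((1 + i%:R) *: p`_i - i%:R *: p`_i.+1), (p`_i.+1 - p`_i) => t ti.
by rewrite (polygonE p ti); apply/rowP => j; rewrite !mxE; ring.
Qed.

Lemma polygon_right (p : seq 'rV[R]_3) t : 0 <= t -> ray_affine (polygon p) t 1.
Proof. by move=> t0; apply: affine_piece_right (polygon_piece p _) (truncn_itv t0). Qed.

Lemma polygon_left (p : seq 'rV[R]_3) t : 0 < t -> ray_affine (polygon p) t (-1).
Proof.
move=> t0; have /andP[le_t lt_t] := truncn_itv (ltW t0).
(* At a node [Num.truncn] selects the segment on the right, so the left germ is taken from the
   previous one. *)
move: le_t; rewrite le_eqVlt => /orP[/eqP tE|lt_t'].
  have : (0 < Num.truncn t)%N by rewrite -(ltr_nat R) tE.
  case E: (Num.truncn t) => [//|i] _.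
  apply: affine_piece_left (polygon_piece p i) _.
  by rewrite -tE E ltr_nat ltnSn lexx.
by apply: affine_piece_left (polygon_piece p (Num.truncn t)) _; rewrite lt_t' ltW.
Qed.

Lemma close_with_locally_affine p g : (1 < size p)%N -> piecewise_affine g ->
  last 0 p = g 1 -> locally_affine (close_with p g).
Proof.
move=> p1 /piecewise_affine_locally [gr gl] pg.
pose n : R := (size p).-1%:R.
have n0 : 0 < n by rewrite ltr0n; case: (size p) p1 => [|[]].
have closeL t : t <= 2^-1 -> close_with p g t = polygon p (2 * t * n).
  by move=> t2; rewrite /close_with t2.
have closeR t : 2^-1 <= t -> close_with p g t = g (2 - 2 * t).
  rewrite le_eqVlt => /orP[/eqP <-|t2]; last by rewrite /close_with leNgt t2.
  rewrite closeL // mulfV ?pnatr_eq0 // mul1r polygon_nat nth_last pg; congr g; lra.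
split=> t /andP[t0 t1].
  have [t2|t2] := ltP t 2^-1.
    have d0 : 0 < 2^-1 - t by lra.
    apply: (ray_affine_eq (u := 2 * t * n) (e := 2 * n * 1) d0) => [s /andP[s0 sd]|].
      by rewrite closeL; [congr polygon; ring|lra].
    by apply: ray_affine_scale; [lra|apply: polygon_right; rewrite !mulr_ge0 // ltW].
  (* The second half runs [g] backwards at double speed: right germs of the closed curve are left
     germs of [g]. *)
  apply: (ray_affine_eq (u := 2 - 2 * t) (e := 2 * -1) ltr01) => [s /andP[s0 sd]|].
    by rewrite closeR; [congr g; ring|lra].
  by apply: ray_affine_scale; [lra|apply: gl; lra].
have [t2|t2] := leP t 2^-1.
  apply: (ray_affine_eq (u := 2 * t * n) (e := 2 * n * -1) ltr01) => [s /andP[s0 sd]|].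
    by rewrite closeL; [congr polygon; ring|lra].
  by apply: ray_affine_scale; [lra|apply: polygon_left; rewrite !mulr_gt0].
have d0 : 0 < t - 2^-1 by lra.
apply: (ray_affine_eq (u := 2 - 2 * t) (e := 2 * 1) d0) => [s /andP[s0 sd]|].
  by rewrite closeR; [congr g; ring|lra].
by apply: ray_affine_scale; [lra|apply: gr; lra].
Qed.

End LocallyAffine.

(** * Tricoloured faces *)

Section Other.
Variables (T : finType) (e : rel T).
Hypotheses (exx : reflexive e) (esym : symmetric e).
Hypothesis e3 : forall x y z, e x y -> e x z -> [|| x == y, x == z | y == z].

(** The partner of [x] when there is one. The default [x] matters: fixed points are exactly the
    elements without a partner, such as faces on the boundary of the cube. *)
Definition other x := odflt x [pick y | e x y && (y != x)].

Lemma other_rel x : e x (other x).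
Proof. by rewrite /other; case: pickP => //= y /andP[]. Qed.

Lemma otherP x y : e x y -> y = x \/ y = other x.
Proof.
move=> exy; rewrite /other; case: pickP => [z /andP[exz zx]|/(_ y)] /=.
  have /or3P[/eqP ->|/eqP xz|/eqP ->] := e3 exy exz; [by left| |by right].
  by rewrite xz eqxx in zx.
by rewrite exy /=; case: eqP => // ->; left.
Qed.

Lemma other_neq x y : e x y -> y != x -> other x != x.
Proof. by move=> /otherP[->|->] //; rewrite eqxx. Qed.

Lemma otherK : involutive other.
Proof.
move=> x; have := other_rel x; rewrite esym => /otherP[xo|<- //].
by rewrite -!xo.
Qed.

End Other.

Section InvolutionPath.
Variables (T : finType) (s t : T -> T) (D : pred T) (x0 : T).
Hypotheses (sK : involutive s) (tK : involutive t).
Hypotheses (sD : forall x, D x -> D (s x)) (tD : forall x, D x -> D (t x)).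
Hypotheses (s_neq : forall x, D x -> s x != x) (x0D : D x0) (tx0 : t x0 = x0).

Let phi x := t (s x).
Let y i := iter i phi x0.

Lemma iter_involutionsD i : D (y i).
Proof. by elim: i => //= i IH; apply/tD/sD. Qed.

(* Conjugation by either involution inverts t \o s; so each of them reverses
   the cycle of x0, which has even length because s fixes no point of it, and
   t fixes the point opposite to x0. *)
Lemma involution_path : exists2 L : nat, (0 < L)%N &
  [/\ t (y L) = y L,
      forall i j, (i <= L)%N -> (j <= L)%N -> y i = y j -> i = j,
      forall i j, (i <= L)%N -> (j <= L)%N -> t (y i) = y j ->
        i = j /\ (i == 0 \/ i == L)%N
    & forall i j, (i < L)%N -> (j < L)%N -> s (y i) <> y j].
Proof.
have phiI : injective phi by apply: inj_comp; apply: inv_inj.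
pose n := fingraph.order phi x0.
have yn : y n = x0 by rewrite /y /n iter_order.
have n0 : (0 < n)%N by apply: fingraph.order_gt0.
have yI i j : (i < n)%N -> (j < n)%N -> y i = y j -> i = j.
  move=> li lj; rewrite /y -!(nth_traject phi (n := n)) // => /eqP.
  rewrite nth_uniq ?size_traject ?orbit_uniq //; first by move/eqP.
have iterI i : injective (iter i phi) by elim: i => //= i IH a b /phiI/IH.
(* After [i] more applications of [phi] the claim reads [phi^i (t (phi^i x)) = t x] at [x0]; it
   follows from [phi (t (phi x)) = t x]. *)
have ty i : (i <= n)%N -> t (y i) = y (n - i)%N.
  move=> li; apply: (iterI i); rewrite /y -iterD subnKC // -/(y n) yn.
  rewrite -[RHS]tx0 /y; elim: i {li} (x0) => //= i IH x.
  by rewrite -iterS iterSr -[in RHS](IH x) /phi tK sK.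
have sy i : (i < n)%N -> s (y i) = y (n - i.+1)%N.
  move=> li; apply: phiI; rewrite {1}/phi sK ty ?(ltnW li) //.
  by rewrite -[phi _]/(y _.+1) -subSn // subSS.
have [L nL] : exists L, n = L.*2.
  exists n./2; have := odd_double_half n; case: (boolP (odd n)) => // on nE.
  have lt : (n./2 < n)%N by move: nE; lia.
  have := s_neq (iter_involutionsD n./2); rewrite sy //.
  by rewrite (_ : (n - _)%N = n./2) ?eqxx //; move: nE; lia.
exists L; first by move: n0; rewrite nL; lia.
split.
- by rewrite ty nL; [congr y; lia|lia].
- by move=> i j li lj; apply: yI; move: n0; lia.
- move=> i j li lj; rewrite ty; last by lia.
  have [->|i0] := posnP i.
    rewrite subn0 yn -[x0]/(y 0) => /yI -> //; [by split; [|left]|lia].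
  by move=> /yI ij; have := ij; rewrite ij; lia.
- move=> i j li lj; rewrite sy; last by lia.
  by move=> /yI; lia.
Qed.

End InvolutionPath.

(** * Ranks of the axes in a Kuhn tetrahedron *)

(** The position of axis [i] in the chain: rank 0 is the smallest local coordinate. In terms of
    ranks, vertices and centres have closed formulas that [lia] can handle. *)
Definition rank (rho : 'S_3) (i : 'I_3) : nat := (rho^-1)%g i.

Lemma rank_lt3 rho i : (rank rho i < 3)%N.
Proof. exact: ltn_ord. Qed.

Lemma rank_inj rho : injective (rank rho).
Proof. by move=> i j /val_inj /perm_inj. Qed.

Lemma rank_perm rho i : rank rho (rho i) = i.
Proof. by rewrite /rank permK. Qed.

Lemma eq_rank rho rho' : rank rho =1 rank rho' -> rho = rho'.
Proof.
by move=> E; apply: invg_inj; apply/permP => i; apply: val_inj; apply: E.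
Qed.

Lemma rankP rho : [/\ (rank rho axis1 < 3)%N, (rank rho axis2 < 3)%N,
    (rank rho axis3 < 3)%N, rank rho axis1 <> rank rho axis2
  & rank rho axis1 <> rank rho axis3 /\ rank rho axis2 <> rank rho axis3].
Proof.
by split; rewrite ?rank_lt3 //; try split;
  move=> /rank_inj/(congr1 val); rewrite /= !inordK.
Qed.

Lemma rank_sum rho : (rank rho axis1 + rank rho axis2 + rank rho axis3 = 3)%N.
Proof. by case: (rankP rho) => ? ? ? ? [? ?]; lia. Qed.

Lemma lt_rank_sum rho (m : nat) : (m < 4)%N ->
  ((rank rho axis1 < m) + (rank rho axis2 < m) + (rank rho axis3 < m) = m)%N.
Proof.
by move=> m4; case: (rankP rho) => ? ? ? ? [? ?]; have := rank_sum rho; lia.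
Qed.

Lemma relabel_rank rho (f : nat -> nat) : (forall v, v < 3 -> f v < 3)%N ->
  (forall v w, v < 3 -> w < 3 -> f v = f w -> v = w)%N ->
  exists rho', forall i, rank rho' i = f (rank rho i).
Proof.
move=> f3 fI.
have gI : injective (fun v : 'I_3 => inord (f v) : 'I_3).
  by move=> v w /(congr1 val); rewrite /= !inordK ?f3 // => /fI vw; apply/val_inj/vw.
exists ((perm gI)^-1 * rho)%g => i.
by rewrite /rank invMg invgK permM permE inordK ?f3.
Qed.

(** * Faces as flags: gluing along equal centres and tricoloured faces of a tetrahedron *)

Section Flags.
Variable N : nat.
Notation flag := (cell N * 'S_3 * 'I_4)%type.
Implicit Types x y z : flag.

(* Three times the i-th coordinate of the centre of the face x. *)
Definition bary x (i : 'I_3) : nat :=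
  (3 * x.1.1 i + rank x.1.2 i + (rank x.1.2 i < x.2))%N.

Definition same_bary x y := [forall i, bary x i == bary y i].

Lemma same_baryP x y : reflect (bary x =1 bary y) (same_bary x y).
Proof. exact: eqfunP. Qed.

Lemma eq_flag x y : (forall i, x.1.1 i = y.1.1 i :> nat) ->
  rank x.1.2 =1 rank y.1.2 -> x.2 = y.2 :> nat -> x = y.
Proof.
case: x y => [[k rho] m] [[k' rho'] m'] /= kk /eq_rank -> /val_inj ->.
by congr (_, _, _); apply/ffunP => i; apply/val_inj/kk.
Qed.

(** Exactly [m] ranks are below [m], so the entries of [bary x] add up to [x.2] modulo 3. This
    residue determines an index among 0, ..., 3 up to exchanging 0 and 3. *)
Lemma same_bary_index x y : same_bary x y ->
  [\/ x.2 = y.2 :> nat, (x.2 = 0 :> nat /\ y.2 = 3 :> nat)%N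
    | (x.2 = 3 :> nat /\ y.2 = 0 :> nat)%N].
Proof.
move=> /same_baryP E; move: (E axis1) (E axis2) (E axis3); rewrite /bary.
have := lt_rank_sum x.1.2 (ltn_ord x.2); have := lt_rank_sum y.1.2 (ltn_ord y.2).
have := rank_sum x.1.2; have := rank_sum y.1.2.
have := ltn_ord x.2; have := ltn_ord y.2.
do 3!move: (nat_of_bool (_ < x.2)%N) => ?.
do 3!move: (nat_of_bool (_ < y.2)%N) => ?.
move=> ? ? ? ? ? ? ? ? ?.
have [|[[]|[]]] : x.2 = y.2 :> nat \/ (x.2 = 3 :> nat /\ y.2 = 0 :> nat)%N \/
  (x.2 = 0 :> nat /\ y.2 = 3 :> nat)%N by lia.
- by constructor 1.
- by constructor 3.
- by constructor 2.
Qed.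

(** For the indices 0 and 3 the indicator in [bary] is constant, and division by 3 recovers both
    corner and rank. *)
Lemma same_bary_outer x y : same_bary x y -> x.2 = y.2 :> nat ->
  (x.2 = 0 :> nat \/ x.2 = 3 :> nat)%N -> x = y.
Proof.
move=> /same_baryP E m m03; apply: eq_flag => // i; move: (E i); rewrite /bary;
  have := rank_lt3 x.1.2 i; have := rank_lt3 y.1.2 i; lia.
Qed.

(** For the indices 1 and 2, the ranks [x.2.-1] and [x.2] give the same residue modulo 3 and the
    third rank another one. The only freedom is to exchange these two axes, and it is gone once one
    of them has a known rank. *)
Lemma same_bary_inner x y i : same_bary x y -> x.2 = y.2 :> nat ->
  (x.2 = 1 :> nat \/ x.2 = 2 :> nat)%N -> rank x.1.2 i = x.2.-1 \/ rank x.1.2 i = x.2 ->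
  rank y.1.2 i = rank x.1.2 i -> x = y.
Proof.
move=> /same_baryP E m m12 xi yi; apply: eq_flag => // j; move: (E j); rewrite /bary;
  have := rank_lt3 x.1.2 j; have := rank_lt3 y.1.2 j; first by lia.
have [->|ji] := eqVneq j i; first by rewrite yi.
have : rank x.1.2 j <> rank x.1.2 i by move/rank_inj => /eqP; apply/negP.
have : rank y.1.2 j <> rank y.1.2 i by move/rank_inj => /eqP; apply/negP.
by lia.
Qed.

Lemma same_bary_uniq x y z : same_bary x y -> same_bary x z ->
  [|| x == y, x == z | y == z].
Proof.
move=> xy xz.
have yz : same_bary y z.
  by apply/same_baryP => i; rewrite -(same_baryP _ _ xy) (same_baryP _ _ xz).
(* Outer faces (index 0 or 3) lie in a side of their unit cube; inner faces are shared within one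
   cell. Among three outer flags two have the same index. *)
have [x03|x12] : (x.2 = 0 :> nat \/ x.2 = 3 :> nat)%N \/ (x.2 = 1 :> nat \/ x.2 = 2 :> nat)%N.
- by have := ltn_ord x.2; lia.
- have ixy := same_bary_index xy; have ixz := same_bary_index xz.
  have [exy|nxy] := eqVneq (x.2 : nat) y.2; first by rewrite (same_bary_outer xy exy) ?eqxx.
  have [exz|nxz] := eqVneq (x.2 : nat) z.2; first by rewrite (same_bary_outer xz exz) ?eqxx ?orbT.
  have eyz : y.2 = z.2 :> nat by case: ixy; case: ixz; lia.
  by rewrite (same_bary_outer yz eyz) ?eqxx ?orbT //; case: ixy; lia.
have exy : x.2 = y.2 :> nat by case: (same_bary_index xy); lia.
have exz : x.2 = z.2 :> nat by case: (same_bary_index xz); lia.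
have m3 : (x.2.-1 < 3)%N by lia.
pose i := x.1.2 (Ordinal m3); have xi : rank x.1.2 i = x.2.-1 by rewrite rank_perm.
have := same_baryP _ _ xy i; have := same_baryP _ _ xz i; rewrite /bary => Ez Ey.
have y3 := rank_lt3 y.1.2 i; have z3 := rank_lt3 z.1.2 i.
(* Pigeonhole: the axis [i] has rank [x.2.-1] or [x.2] in each of the three flags, and two flags
   that agree on it are equal. *)
have [yi|yi] := eqVneq (rank y.1.2 i) x.2.-1.
  by rewrite (same_bary_inner (i := i) xy exy) ?eqxx ?yi ?xi //; left.
have [zi|zi] := eqVneq (rank z.1.2 i) x.2.-1.
  by rewrite (same_bary_inner (i := i) xz exz) ?eqxx ?zi ?xi ?orbT //; left.
have yx : rank y.1.2 i = x.2 by lia.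
have zx : rank z.1.2 i = x.2 by lia.
rewrite (same_bary_inner (i := i) yz) ?eqxx ?orbT -?exy -?exz //; last by rewrite yx zx.
by right.
Qed.

Lemma vertex_bary x y (j : 'I_4) : same_bary x y -> j != x.2 ->
  exists2 j' : 'I_4, j' != y.2 & vertex x.1.1 x.1.2 j = vertex y.1.1 y.1.2 j'.
Proof.
move=> xy; have := same_bary_index xy; move: xy => /same_baryP E m jx.
(* The cyclic shift of vertex numbers that takes the omitted vertex [x.2] to [y.2]: the identity for
   equal indices, a shift by one when a face of index 0 is glued to one of index 3. *)
exists (inord ((j + (y.2 + 4 - x.2)) %% 4)).
  rewrite -val_eqE /= inordK ?ltn_mod //; move: jx; rewrite -val_eqE /=.
  by have := ltn_ord j; have := ltn_ord x.2; have := ltn_ord y.2; case: m; lia.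
apply/ffunP => i; rewrite !ffunE; congr inord.
rewrite inordK ?ltn_mod //; move: (E i); rewrite /bary -/(rank _ _) -/(rank _ _).
have := rank_lt3 x.1.2 i; have := rank_lt3 y.1.2 i.
move: jx; rewrite -val_eqE /=.
have := ltn_ord j; have := ltn_ord x.2; have := ltn_ord y.2; case: m; lia.
Qed.

Definition tricoloured (col : site N -> 'I_3) x :=
  three_coloured col (face x.1.1 x.1.2 x.2).

Lemma tricolouredP col x : reflect
  (forall c, exists2 j, j != x.2 & col (vertex x.1.1 x.1.2 j) = c) (tricoloured col x).
Proof.
apply: (iffP forallP) => h c.
  have /mapP[_ /mapP[j + ->] ->] := h c.
  by rewrite mem_filter => /andP[jx _]; exists j.
have [j jx <-] := h c; apply/map_f/map_f; by rewrite mem_filter jx mem_enum.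
Qed.

Lemma tricoloured_bary col x y : same_bary x y -> tricoloured col x -> tricoloured col y.
Proof.
move=> xy /tricolouredP h; apply/tricolouredP => c; have [j jx jc] := h c.
have [j' j'y vE] := vertex_bary xy jx; exists j' => //; by rewrite -vE.
Qed.

Definition cell_of (g : 'I_3 -> nat) (gN : forall i, (g i < N)%N) : cell N :=
  [ffun i => Ordinal (gN i)].

Lemma same_bary_ex x : (forall i, 0 < bary x i < 3 * N)%N ->
  exists2 y, same_bary x y & y != x.
Proof.
move=> xN.
(* The partner is sought as a corner [g], a relabelling [f] of the ranks and an index [n]; it is a
   different flag if the index changes or [f] moves a rank. *)
suff [g [f [n [gN f3 fI E ne]]]] : exists (g : 'I_3 -> nat) (f : nat -> nat) (n : 'I_4),
    [/\ forall i, (g i < N)%N, forall v, (v < 3 -> f v < 3)%N,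
       forall v w, (v < 3 -> w < 3 -> f v = f w -> v = w)%N,
       forall i, bary x i = (3 * g i + f (rank x.1.2 i) + (f (rank x.1.2 i) < n))%N
     & x.2 <> n \/ exists2 v, (v < 3)%N & f v <> v].
  have [rho' r'] := relabel_rank x.1.2 f3 fI.
  exists (cell_of gN, rho', n); first by apply/same_baryP => i; rewrite E /bary /= r' ffunE.
  case: ne => [ne|[v v3 ne]]; apply/eqP => xE; first by apply: ne; rewrite -xE.
  apply: ne; have := r' (x.1.2 (Ordinal v3)); rewrite rank_perm -xE /= => <-.
  by rewrite rank_perm.
have kN i := ltn_ord (x.1.1 i); have r3 i := rank_lt3 x.1.2 i.
have [m|m|m|m] : [\/ x.2 = 0 :> nat, x.2 = 1 :> nat, x.2 = 2 :> nat | x.2 = 3 :> nat]%N.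
  by case: (x.2) => [[|[|[|[|]]]] ?] //=; [constructor 1|constructor 2|constructor 3|constructor 4].
(* On this face the coordinate of rank 0 vanishes. Seen from the cell on the other side it equals 1,
   so its rank becomes 2 and the other ranks drop by one. *)
- exists (fun i => x.1.1 i - (rank x.1.2 i == 0))%N,
    (fun v => if v == 0 then 2 else v.-1)%N, ord_max.
  split.
  + by move=> i; have := kN i; lia.
  + by move=> v; case: eqP; lia.
  + by move=> v w; do 2!case: eqP; lia.
  + by move=> i; move: (xN i) (r3 i); rewrite /bary m /=; case: eqP; lia.
  + by left => xE; rewrite xE in m.
(* Across an inner face one stays in the cell and exchanges the ranks [x.2.-1] and [x.2]: here 0 and
   1, in the next case 1 and 2. *)
- exists (fun i => x.1.1 i),
    (fun v => if (v < 2)%N then (1 - v)%N else v), x.2.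
  split=> //.
  + by move=> v; case: ifP; lia.
  + by move=> v w; do 2!case: ifP; lia.
  + by move=> i; move: (r3 i); rewrite /bary m /=; case: ifP; lia.
  + by right; exists 0.
- exists (fun i => x.1.1 i),
    (fun v => if v == 0 then v else (3 - v)%N), x.2.
  split=> //.
  + by move=> v; case: ifP; lia.
  + by move=> v w; do 2!case: ifP; lia.
  + by move=> i; move: (r3 i); rewrite /bary m /=; case: ifP; lia.
  + by right; exists 1.
(* Inverse of the case of index 0: the coordinate of rank 2 equals 1, hence 0 in the next cell. *)
- exists (fun i => x.1.1 i + (rank x.1.2 i == 2))%N,
    (fun v => if v == 2 then 0 else v.+1)%N, ord0.
  split.
  + by move=> i; move: (xN i) (kN i) (r3 i); rewrite /bary m; case: eqP; lia.
  + by move=> v; case: ifP; lia.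
  + by move=> v w; do 2!case: ifP; lia.
  + by move=> i; move: (r3 i); rewrite /bary m /=; case: ifP; lia.
  + by left => xE; rewrite xE in m.
Qed.

Section Colouring.
Variable col : site N -> 'I_3.

Let c x j := col (vertex x.1.1 x.1.2 j).

Lemma tricolouredP2 x : reflect
  {in [pred j | j != x.2] &, injective (c x)} (tricoloured col x).
Proof.
apply: (iffP (tricolouredP col x)) => [h j j' jx j'x cj|cI c0].
  pose g (i : 'I_3) : 'I_4 := odflt ord0 [pick j | (j != x.2) && (c x j == i)].
  have gP i : g i != x.2 /\ c x (g i) = i.
    rewrite /g; case: pickP => /= [j0 /andP[? /eqP]//|].
    by have [j0 j0x <-] := h i => /(_ j0); rewrite j0x eqxx.
  have gI : injective g by move=> a b ab; rewrite -(gP a).2 -(gP b).2 ab.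
  have gE : #|codom g| = #|[set~ x.2]%SET|.
    by rewrite card_codom // card_ord cardsC1 card_ord.
  have sg : codom g \subset [set~ x.2]%SET.
    by apply/fintype.subsetP => _ /codomP[i ->]; rewrite !inE (gP i).1.
  have gS j0 : j0 != x.2 -> exists i, g i = j0.
    move=> j0x; suff /codomP[i ->] : j0 \in codom g by exists i.
    by rewrite (subset_cardP gE sg) !inE.
  have [i ij] := gS _ jx; have [i' ij'] := gS _ j'x.
  by move: cj; rewrite -ij -ij' !(gP _).2 => ->.
have : c0 \in [set c x j | j in [set~ x.2]%SET]%SET.
  suff -> : [set c x j | j in [set~ x.2]%SET]%SET = finset.setT by rewrite inE.
  apply/eqP; rewrite eqEcard finset.subsetT /= card_in_imset.
    by rewrite cardsT cardsC1 !card_ord.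
  by move=> j j'; rewrite !inE => jx j'x; apply: cI.
by case/imsetP => j; rewrite !inE => jx ->; exists j.
Qed.

(** The disjunct [x == y] makes the relation reflexive on all flags, so [other] applies to it and
    fixes the faces that are not tricoloured. *)
Definition same_tetra x y :=
  (x == y) || [&& x.1 == y.1, tricoloured col x & tricoloured col y].

Lemma same_tetra_refl : reflexive same_tetra.
Proof. by move=> x; rewrite /same_tetra eqxx. Qed.

Lemma same_tetra_sym : symmetric same_tetra.
Proof.
by move=> x y; rewrite /same_tetra eq_sym (eq_sym x.1); congr (_ || (_ && _)); rewrite andbC.
Qed.

(** Two vertices cannot meet all three omitted indices, so they lie together on one of the three
    faces. Three tricoloured faces would therefore give four distinct colours. *)
Lemma same_tetra_uniq x y z : same_tetra x y -> same_tetra x z ->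
  [|| x == y, x == z | y == z].
Proof.
rewrite /same_tetra; have [//|xy /=] := eqVneq x y; have [//|xz /=] := eqVneq x z.
move=> /and3P[/eqP x1y tx ty] /and3P[/eqP x1z _ tz]; apply: contraT => yz.
have ne (u v : flag) : u != v -> u.1 = v.1 -> u.2 != v.2.
  by case: u v => [u1 u2] [v1 v2] /= + uv; rewrite xpair_eqE uv eqxx.
have {}xy := ne _ _ xy x1y; have {}xz := ne _ _ xz x1z.
have {ne yz} yz : y.2 != z.2 by apply: ne => //; rewrite -x1y.
have cI : injective (c x).
  move=> j j' cj; have cy : c x = c y by rewrite /c x1y.
  have cz : c x = c z by rewrite /c x1z.
  have [//|jj'] := eqVneq j j'.
  have [/andP[jx j'x]|xo] := boolP ((j != x.2) && (j' != x.2)).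
    by have /tricolouredP2 := tx; apply.
  have [/andP[jy j'y]|yo] := boolP ((j != y.2) && (j' != y.2)).
    by have /tricolouredP2 := ty; apply; rewrite // -cy.
  have /andP[jz j'z] : (j != z.2) && (j' != z.2).
    move: xo yo; rewrite !negb_and !negbK => /orP[]/eqP E /orP[]/eqP E';
      by move: xy xz yz; rewrite -E -E' ?eqxx // => _ -> ->.
  by have /tricolouredP2 := tz; apply; rewrite // -cz.
by have := leq_card _ cI; rewrite !card_ord.
Qed.

(** The vertex opposite to [x] repeats the colour of some vertex [m] of [x]; replacing [m] by it
    keeps all three colours. *)
Lemma same_tetra_ex x : tricoloured col x -> exists2 y, same_tetra x y & y != x.
Proof.
move=> tx; have /tricolouredP2 cI := tx.
have [m [mx cm]] : exists m, m != x.2 /\ c x m = c x x.2.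
  apply: contrapT => no; have : injective (c x).
    move=> j j'; have [->|jx] := eqVneq j x.2; have [->|j'x] := eqVneq j' x.2 => //.
    - by move=> cj; case: no; exists j'.
    - by move=> cj; case: no; exists j.
    - by apply: cI.
  by move/leq_card; rewrite !card_ord.
exists (x.1, m); last by apply: contra mx => /eqP <-.
rewrite /same_tetra /= eqxx tx /=; apply/orP; right; apply/tricolouredP2.
move=> j j'; rewrite !inE /= /c /= -/(c x j) -/(c x j') => jm j'm.
have [->|jx] := eqVneq j x.2; have [->|j'x] := eqVneq j' x.2 => // cj.
- by move: cj; rewrite -cm => /cI; rewrite !inE => /(_ mx j'x) E; rewrite E eqxx in j'm.
- by move: cj; rewrite -cm => /cI; rewrite !inE => /(_ jx mx) E; rewrite E eqxx in jm.
- by apply: cI.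
Qed.

Definition tau := other same_bary.
Definition sigma := other same_tetra.

Lemma same_bary_refl : reflexive same_bary.
Proof. by move=> x; apply/same_baryP. Qed.

Lemma same_bary_sym : symmetric same_bary.
Proof. by move=> x y; apply/same_baryP/same_baryP => E i. Qed.

Lemma tauK : involutive tau.
Proof. exact: otherK same_bary_refl same_bary_sym same_bary_uniq. Qed.

Lemma sigmaK : involutive sigma.
Proof. exact: otherK same_tetra_refl same_tetra_sym same_tetra_uniq. Qed.

Lemma same_bary_tau x : same_bary x (tau x).
Proof. exact: other_rel same_bary_refl x. Qed.

Lemma same_tetra_sigma x : same_tetra x (sigma x).
Proof. exact: other_rel same_tetra_refl x. Qed.

Lemma same_bary_cases x y : same_bary x y -> y = x \/ y = tau x.
Proof. exact: otherP same_bary_uniq _ _. Qed.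

Lemma same_tetra_cases x y : same_tetra x y -> y = x \/ y = sigma x.
Proof. exact: otherP same_tetra_uniq _ _. Qed.

Lemma tricoloured_tau x : tricoloured col x -> tricoloured col (tau x).
Proof. exact: tricoloured_bary (same_bary_tau x). Qed.

Lemma sigma_tetra x : (sigma x).1 = x.1.
Proof. by case/orP: (same_tetra_sigma x) => [/eqP <-|/and3P[/eqP]]. Qed.

Lemma tricoloured_sigma x : tricoloured col x -> tricoloured col (sigma x).
Proof. by case/orP: (same_tetra_sigma x) => [/eqP <-|/and3P[]]. Qed.

Lemma sigma_neq x : tricoloured col x -> sigma x != x.
Proof. by move=> /same_tetra_ex[y]; apply: other_neq same_tetra_uniq _ _. Qed.

Lemma tau_fixed x : tau x = x -> exists i, bary x i = 0%N \/ bary x i = (3 * N)%N.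
Proof.
move=> tx; apply: contrapT => no.
have [|y xy] := @same_bary_ex x; last first.
  by move=> /(other_neq same_bary_uniq xy); rewrite -/tau tx eqxx.
move=> i; apply: contrapT => xi; apply: no; exists i.
have := ltn_ord (x.1.1 i); have := rank_lt3 x.1.2 i; move: xi; rewrite /bary; lia.
Qed.

End Colouring.

Lemma vertex_rank (k : cell N) rho (j : 'I_4) i :
  vertex k rho j i = (k i + (j <= rank rho i))%N :> nat.
Proof.
rewrite ffunE inordK // ltnS -/(rank rho i).
by have := ltn_ord (k i); case: (j <= _)%N => /=; lia.
Qed.

End Flags.

(* The prescribed colour of a boundary site, obtained by testing in this order
   the sides x_2 = N, x_1 = 0, x_3 = N and then the three others. *)
Definition dobrushin_colour (N a b c : nat) : nat :=
  (if b == N then 0 else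
   if a == 0 then (if (c == 0) && (b != 0) then 2 else 0) else
   if c == N then 1 else
   if (a == N) || (c == 0) then 2 else 1)%N.

Lemma dobrushin_colour0 N a b c : 0%N = dobrushin_colour N a b c -> b = N \/ a = 0%N.
Proof. by rewrite /dobrushin_colour; do !case: eqP => //=; auto. Qed.

Lemma dobrushin_colour1 N a b c : 1%N = dobrushin_colour N a b c ->
  [/\ b <> N, a <> 0%N & c = N \/ (c <> 0%N /\ a <> N)].
Proof. by rewrite /dobrushin_colour; do !case: eqP => //=; split; auto. Qed.

Lemma dobrushin_colour2 N a b c : 2%N = dobrushin_colour N a b c ->
  b <> N /\ ((a = 0%N /\ c = 0%N /\ b <> 0%N) \/ (a <> 0%N /\ c <> N /\ (a = N \/ c = 0%N))).
Proof. by rewrite /dobrushin_colour; do !case: eqP => //=; lia. Qed.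

Definition on_boundary N (x : site N) := [exists i, (x i == 0 :> nat) || (x i == N :> nat)].

Definition dobrushin_boundary N (col : site N -> 'I_3) := forall x : site N, on_boundary x ->
  col x = dobrushin_colour N (x axis1) (x axis2) (x axis3) :> nat.

Lemma forall_axis (Q : pred 'I_3) : [forall i, Q i] = [&& Q axis1, Q axis2 & Q axis3].
Proof.
apply/forallP/and3P => [h|[h1 h2 h3]]; first by split; apply: h.
exact: axis_ind.
Qed.

Lemma mksiteE N a b c : (a <= N -> b <= N -> c <= N ->
  [/\ mksite N a b c axis1 = a :> nat, mksite N a b c axis2 = b :> nat
    & mksite N a b c axis3 = c :> nat])%N.
Proof. by move=> ? ? ?; split; rewrite ffunE /= !inordK //= inordK. Qed.

Lemma eq_mksite N (x : site N) a b c : (a <= N -> b <= N -> c <= N ->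
  (x == mksite N a b c) =
  [&& x axis1 == a :> nat, x axis2 == b :> nat & x axis3 == c :> nat])%N.
Proof.
move=> aN bN cN; have [E1 E2 E3] := mksiteE aN bN cN.
apply/eqP/and3P => [->|[/eqP x1 /eqP x2 /eqP x3]]; first by rewrite E1 E2 E3.
by apply/ffunP; apply: axis_ind; apply: val_inj; rewrite /= ?E1 ?E2 ?E3.
Qed.

Lemma dobrushin_colourP N (x : site N) : (0 < N)%N -> on_boundary x ->
  [\/ dobrushin_colour N (x axis1) (x axis2) (x axis3) = 0 /\ boundary0 x,
      dobrushin_colour N (x axis1) (x axis2) (x axis3) = 1 /\ boundary1 x
    | dobrushin_colour N (x axis1) (x axis2) (x axis3) = 2 /\ boundary2 x]%N.
Proof.
move=> N0 /existsP[i0 xb].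
rewrite /boundary0 /boundary1 /boundary2 /on_face /on_edge !forall_axis !axis_eqE !eqxx.
rewrite !inE !eq_mksite //= ?andbT /strictly_inside /dobrushin_colour.
have lt i : (x i <= N)%N := ltn_ord (x i).
(* Each coordinate is 0, [N] or strictly between: 27 cases, of which only the interior one
   contradicts [on_boundary]. *)
have cls i : [\/ [/\ (x i == 0 :> nat)%N, (x i == N :> nat) = false, (0 < x i)%N = false & (x i < N)%N],
    [/\ (x i == 0 :> nat)%N = false, (x i == N :> nat) = true, (0 < x i)%N & (x i < N)%N = false]
  | [/\ (x i == 0 :> nat)%N = false, (x i == N :> nat) = false, (0 < x i)%N & (x i < N)%N]].
  have := lt i; have [x0|x0] := eqVneq (x i : nat) 0%N.
    by constructor 1; rewrite x0; split=> //; lia.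
  have [xN|xN] := eqVneq (x i : nat) N; first by constructor 2; rewrite xN; split; lia.
  by constructor 3; split; lia.
case: (cls axis1) => [[z1 n1 p1 q1]|[z1 n1 p1 q1]|[z1 n1 p1 q1]];
case: (cls axis2) => [[z2 n2 p2 q2]|[z2 n2 p2 q2]|[z2 n2 p2 q2]];
case: (cls axis3) => [[z3 n3 p3 q3]|[z3 n3 p3 q3]|[z3 n3 p3 q3]];
rewrite z1 n1 p1 q1 z2 n2 p2 q2 z3 n3 p3 q3 /=;
do ?[by constructor 1|by constructor 2|by constructor 3].
by exfalso; move: i0 xb; apply: axis_ind; rewrite ?z1 ?n1 ?z2 ?n2 ?z3 ?n3.
Qed.

(** The tetrahedron x_2 <= x_3 <= x_1: its face of index 0 in the first cell is f, its face of index
    3 in the last cell is f'. *)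
Lemma face_ranks_ex : exists rho, [/\ rank rho axis1 = 2, rank rho axis2 = 0 & rank rho axis3 = 1]%N.
Proof.
have [||rho r] := @relabel_rank 1%g (fun v => (v + 2) %% 3)%N.
- by move=> v _; rewrite ltn_mod.
- by move=> v w; lia.
by exists rho; rewrite !r /rank invg1 !perm1 /= !inordK.
Qed.

(** * Tricoloured faces on the boundary of the cube *)

Section BoundaryFaces.
Variable N : nat.
Notation flag := (cell N * 'S_3 * 'I_4)%type.
Implicit Types x y : flag.

(** Three times the centres of f and f' are (2, 0, 1) and (3N, 3N - 2, 3N - 1); successors avoid
    truncated subtraction. *)
Definition start_face x := [&& bary x axis1 == 2, bary x axis2 == 0 & bary x axis3 == 1]%N.
Definition end_face x :=
  [&& bary x axis1 == 3 * N, (bary x axis2).+2 == 3 * N & (bary x axis3).+1 == 3 * N]%N.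

Lemma start_face_ex (N0 : (0 < N)%N) : exists x, start_face x.
Proof.
have [rho [r1 r2 r3]] := face_ranks_ex.
exists (cell_of (fun=> N0), rho, ord0).
by rewrite /start_face /bary /= r1 r2 r3 !ffunE.
Qed.

Lemma end_face_ex (N0 : (0 < N)%N) : exists x, end_face x.
Proof.
have [rho [r1 r2 r3]] := face_ranks_ex.
have N1 : (N.-1 < N)%N by lia.
exists (cell_of (fun=> N1), rho, ord_max).
by rewrite /end_face /bary /= r1 r2 r3 !ffunE /=; lia.
Qed.

Lemma start_face_same x y : start_face x -> same_bary x y = start_face y.
Proof.
rewrite /start_face => /and3P[/eqP x1 /eqP x2 /eqP x3].
by rewrite /same_bary forall_axis x1 x2 x3 !(eq_sym _ (bary y _)).
Qed.

Lemma end_face_same x y : end_face x -> same_bary x y = end_face y.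
Proof.
rewrite /end_face => /and3P[/eqP x1 /eqP x2 /eqP x3].
by rewrite /same_bary forall_axis x1; apply/idP/idP; lia.
Qed.

Variable col : site N -> 'I_3.
Hypotheses (N0 : (0 < N)%N) (colD : dobrushin_boundary col).

Lemma boundary_colour x i (j : 'I_4) :
  (vertex x.1.1 x.1.2 j i = 0 :> nat \/ vertex x.1.1 x.1.2 j i = N :> nat)%N ->
  col (vertex x.1.1 x.1.2 j) = dobrushin_colour N
    (x.1.1 axis1 + (j <= rank x.1.2 axis1)) (x.1.1 axis2 + (j <= rank x.1.2 axis2))
    (x.1.1 axis3 + (j <= rank x.1.2 axis3)) :> nat.
Proof.
move=> ji; rewrite colD ?vertex_rank //; apply/existsP; exists i.
by case: ji => ->; rewrite eqxx ?orbT.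
Qed.

(** An extreme coordinate of the centre puts all three vertices in that side. The sides x_1 = 0, x_2
    = N and x_3 = 0 lack colour 1, and x_3 = N lacks colour 2. In x_1 = N, colour 0 needs x_2 = N
    and colour 1 needs x_3 = N, which leaves f' only. In x_2 = 0, colour 0 needs x_1 = 0, and
    separating colours 1 and 2 next to that edge leaves f only. *)
Lemma tricoloured_boundary x i : (bary x i = 0 \/ bary x i = 3 * N)%N ->
  tricoloured col x -> start_face x \/ end_face x.
Proof.
move=> xi /tricolouredP tx.
have side j : j != x.2 -> (vertex x.1.1 x.1.2 j i = 0 :> nat \/ vertex x.1.1 x.1.2 j i = N :> nat)%N.
  rewrite -val_eqE vertex_rank /=; move: xi; rewrite /bary.
  have := ltn_ord (x.1.1 i); have := rank_lt3 x.1.2 i; have := ltn_ord j; have := ltn_ord x.2; lia.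
have colE c : (c < 3)%N -> exists j : nat, [/\ (j < 4)%N, j <> x.2 & c = dobrushin_colour N
    (x.1.1 axis1 + (j <= rank x.1.2 axis1)) (x.1.1 axis2 + (j <= rank x.1.2 axis2))
    (x.1.1 axis3 + (j <= rank x.1.2 axis3))].
  move=> c3; have [j jx jc] := tx (Ordinal c3).
  exists j; split; first exact: ltn_ord.
    by apply/eqP; rewrite val_eqE.
  by rewrite -(boundary_colour (side _ jx)) jc.
have [j0 [j04 j0x]] := colE 0%N isT.
have [j1 [j14 j1x]] := colE 1%N isT.
have [j2 [j24 j2x]] := colE 2%N isT.
move=> /dobrushin_colour2 c2 /dobrushin_colour1 c1 /dobrushin_colour0 c0.
case: (rankP x.1.2) => r1 r2 r3 r12 [r13 r23].
have k1 := ltn_ord (x.1.1 axis1); have k2 := ltn_ord (x.1.1 axis2); have k3 := ltn_ord (x.1.1 axis3).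
have m4 := ltn_ord x.2.
suff : (bary x axis1 = 2 /\ bary x axis2 = 0 /\ bary x axis3 = 1)%N \/
    (bary x axis1 = 3 * N /\ (bary x axis2).+2 = 3 * N /\ (bary x axis3).+1 = 3 * N)%N.
  by case=> -[/eqP ? [/eqP ? /eqP ?]]; [left|right]; apply/and3P.
have low i0 : bary x i0 = 0%N -> [/\ x.2 = 0 :> nat, rank x.1.2 i0 = 0 & x.1.1 i0 = 0 :> nat]%N.
  by rewrite /bary; have := rank_lt3 x.1.2 i0; clear; split; lia.
have high i0 : bary x i0 = (3 * N)%N -> [/\ x.2 = 3 :> nat, rank x.1.2 i0 = 2 & (x.1.1 i0).+1 = N]%N.
  by rewrite /bary; move: (ltn_ord (x.1.1 i0)) (rank_lt3 x.1.2 i0) m4; clear; split; lia.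
case: c1 => c1b c1a c1c.
move: i xi {side colE tx}; apply: axis_ind.
- case=> [/low|/high] [m r k].
    by move: c1a; rewrite r k; clear -m j1x; lia.
  rewrite /bary m r; right.
  have [j1r j0r] : (j1 <= 2 /\ j0 <= 2)%N by clear - m j04 j14 j0x j1x; lia.
  move: c1c c0; rewrite r j1r j0r addn1 k => -[c1c|[]//] [c0b|]; last by clear -N0; lia.
  by move: c1b c1c c0b r r12 r13 r23 r1 r2 r3 k2 k3 k j04 j14; clear; lia.
- case=> [/low|/high] [m r k]; last first.
    by exfalso; move: c1b; rewrite r; clear -k m j1x j14; lia.
  left; rewrite /bary m r k.
  have [j1r j2r j0r] : [/\ (j1 <= 0 = false), (j2 <= 0 = false) & (j0 <= 0 = false)]%N.
    by clear -m j0x j1x j2x; split; lia.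
  move: c0 c1a c1c c2; rewrite r k j0r j2r addn0 => c0 c1a c1c c2.
  have {c0} [k10 j0r1] : (x.1.1 axis1 = 0 :> nat /\ rank x.1.2 axis1 < j0)%N.
    by clear -c0 N0; case: c0; lia.
  rewrite k10 in c1a c1c c2 *.
  have j1r1 : (j1 <= rank x.1.2 axis1)%N by clear -c1a; lia.
  rewrite j1r1 in c1a c1c.
  have [[_ [_ b0]]|[a2 [c2' c2'']]] := c2.2; first by case: b0.
  have j2r1 : (j2 <= rank x.1.2 axis1)%N by clear -a2; lia.
  rewrite j2r1 in a2 c2' c2''.
  by clear -k3 c2' c2'' c1c r12 r13 r23 r1 r3 r j1r1 j1r j2r j0r1 j04 j2r1; lia.
- case=> [/low|/high] [m r k]; exfalso.
    by clear -c1c r k m j1x N0; case: c1c; rewrite r k; lia.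
  by clear -c2 r k m j2x j24 N0; case: c2 => _; rewrite r; lia.
Qed.

End BoundaryFaces.

(** * The three-colour line from f *)

Section Walk.
Variables (N : nat) (col : site N -> 'I_3).
Hypotheses (N0 : (0 < N)%N) (colD : dobrushin_boundary col).
Notation flag := (cell N * 'S_3 * 'I_4)%type.
Implicit Types x y : flag.

Lemma start_face_tricoloured x : start_face x -> tricoloured col x.
Proof.
have [rho [r1 r2 r3]] := face_ranks_ex.
pose x0 : flag := (cell_of (fun=> N0), rho, ord0).
have x0s : start_face x0 by rewrite /start_face /bary /= r1 r2 r3 !ffunE.
rewrite -(start_face_same x x0s) => /tricoloured_bary; apply.
have colE (j : 'I_4) : j != x0.2 -> col (vertex x0.1.1 x0.1.2 j) =
    dobrushin_colour N (j <= 2)%N (j <= 0)%N (j <= 1)%N :> nat.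
  move=> j0; rewrite (boundary_colour colD (i := axis2)) ?vertex_rank /= ?r1 ?r2 ?r3 ?[cell_of _ _]ffunE //.
  by left; move: j0; rewrite -val_eqE /=; case: (j : nat).
apply/tricolouredP => -[[|[|[|c]]] cl] //.
(* The vertices 3, 1, 2 are (0,0,0), (1,0,1), (1,0,0), with colours 0, 1, 2. For N = 1 the
   coordinate 1 is also [N], hence the case distinctions on [N]. *)
- exists (inord 3); first by rewrite -val_eqE /= inordK.
  by apply: val_inj; rewrite /= colE -?val_eqE /= !inordK // /dobrushin_colour; move: N0; case: (N).
- exists (inord 1); first by rewrite -val_eqE /= inordK.
  by apply: val_inj; rewrite /= colE -?val_eqE /= !inordK // /dobrushin_colour; move: N0; case: (N) => [|[|]].
- exists (inord 2); first by rewrite -val_eqE /= inordK.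
  by apply: val_inj; rewrite /= colE -?val_eqE /= !inordK // /dobrushin_colour; move: N0; case: (N) => [|[|]].
Qed.

(** A coordinate 0 of the centre forces index 0 and a coordinate 3N forces index 3, for the face and
    for its partner alike; outer faces with equal centres and indices coincide. *)
Lemma boundary_tau x i : bary x i = 0%N \/ bary x i = (3 * N)%N -> tau x = x.
Proof.
have end_index (k r m : nat) : (k < N)%N -> (r < 3)%N -> (m < 4)%N ->
    ((3 * k + r + (r < m) = 0 -> m = 0) /\ (3 * k + r + (r < m) = 3 * N -> m = 3))%N.
  by move=> kN r3 m4; split; lia.
move=> xi; have xt := same_bary_tau x.
have [xlo xhi] := end_index _ _ _ (ltn_ord (x.1.1 i)) (rank_lt3 x.1.2 i) (ltn_ord x.2).
have [ylo yhi] := end_index _ _ _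
  (ltn_ord ((tau x).1.1 i)) (rank_lt3 (tau x).1.2 i) (ltn_ord (tau x).2).
symmetry; apply: same_bary_outer => //; have E := same_baryP _ _ xt i.
  by case: xi => xi; [rewrite xlo // ylo // -/(bary _ _) -E|rewrite xhi // yhi // -/(bary _ _) -E].
by case: xi => [/xlo|/xhi]; [left|right].
Qed.

Definition start := xchoose (start_face_ex N0).
Definition walk i := iter i (fun x => tau (sigma col x)) start.

Lemma start_walk : start_face (walk 0).
Proof. exact: (xchooseP (start_face_ex N0)). Qed.

Lemma tricoloured_walk i : tricoloured col (walk i).
Proof.
elim: i => [|i IH]; first exact: start_face_tricoloured start_walk.
exact/tricoloured_tau/tricoloured_sigma.
Qed.

(** The last two clauses, distinct nodes and distinct tetrahedra, are what makes the line simple.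
    The last face is fixed by [tau], hence on the boundary, and it is not f because its centre
    differs from the first one. *)
Lemma walk_ends : exists L, [/\ (0 < L)%N, end_face (walk L),
  forall i j, (i <= L)%N -> (j <= L)%N -> same_bary (walk i) (walk j) -> i = j
  & forall i j, (i < L)%N -> (j < L)%N -> (walk i).1 = (walk j).1 -> i = j].
Proof.
have t0 : tau start = start.
  have /and3P[_ /eqP s2 _] := start_walk.
  by apply: (boundary_tau (i := axis2)); left.
have [L L0 [tL wI tI sI]] := involution_path (sigmaK col) (@tauK N)
  (@tricoloured_sigma N col) (@tricoloured_tau N col) (@sigma_neq N col)
  (tricoloured_walk 0) t0.
have wB i j : (i <= L)%N -> (j <= L)%N -> same_bary (walk i) (walk j) -> i = j.
  move=> iL jL /same_bary_cases[/esym|/esym]; first exact: wI.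
  by move=> /tI [].
exists L; split=> //.
  have [i /(tricoloured_boundary N0 colD)] := tau_fixed tL.
  move=> /(_ (tricoloured_walk L))[] //.
  by rewrite -(start_face_same _ start_walk) => /wB; move: L0; case: (L) => // L' _ /(_ isT (leqnn _)).
move=> i j iL jL ij; have : same_tetra col (walk i) (walk j).
  by apply/orP; right; rewrite ij eqxx !tricoloured_walk.
case/same_tetra_cases => [/esym/wI|/esym/sI]; first by apply; exact: ltnW.
by move=> /(_ iL jL).
Qed.

Lemma walk_inside L : end_face (walk L) ->
  (forall i j, (i <= L)%N -> (j <= L)%N -> same_bary (walk i) (walk j) -> i = j) ->
  forall i a, (0 < i < L)%N -> (0 < bary (walk i) a < 3 * N)%N.
Proof.
move=> eL wB i a /andP[i0 iL]; have bN : (bary (walk i) a <= 3 * N)%N.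
  by rewrite /bary; have := ltn_ord ((walk i).1.1 a); have := rank_lt3 (walk i).1.2 a; lia.
have [//|nb] := boolP (0 < bary (walk i) a < 3 * N)%N; exfalso.
have : bary (walk i) a = 0%N \/ bary (walk i) a = (3 * N)%N by move: bN nb; lia.
move=> /(tricoloured_boundary N0 colD) /(_ (tricoloured_walk i)) [].
  rewrite -(start_face_same _ start_walk) => /wB; move=> /(_ isT (ltnW iL)); lia.
by rewrite -(end_face_same _ eL) => /wB; move=> /(_ (leqnn _) (ltnW iL)); lia.
Qed.

Context {R : realType}.

Definition node x : 'rV[R]_3 := \row_i ((bary x i)%:R / 3).

Lemma node_inj x y : node x = node y <-> same_bary x y.
Proof.
split=> [/rowP E|/same_baryP E]; last by apply/rowP => i; rewrite !mxE E.
apply/same_baryP => i; have := E i; rewrite !mxE => /mulIf E'.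
by apply/eqP; rewrite -(eqr_nat R); apply/eqP/E'; rewrite invr_eq0.
Qed.

Lemma node_tau x : node (tau x) = node x.
Proof. by apply/node_inj; rewrite same_bary_sym same_bary_tau. Qed.

Lemma centre_node x : centre (face x.1.1 x.1.2 x.2) = node x.
Proof.
apply/rowP => i; rewrite !mxE mulrC; congr (_ / _); rewrite summxE /face big_map.
rewrite big_filter big_enum_cond /=.
under eq_bigr do rewrite mxE vertex_rank.
rewrite -natr_sum; congr (_%:R); rewrite /bary.
have := rank_lt3 x.1.2 i.
case: (x.2) => -[|[|[|[|]]]] // m4 r3; rewrite big_mkcond !big_ord_recl big_ord0 /=;
rewrite /bump /=; move: r3; lia.
Qed.

Lemma start_face_centre x : start_face x -> centre (triangle_f N) = node x.
Proof.
move=> /and3P[/eqP x1 /eqP x2 /eqP x3]; apply/rowP; rewrite /centre /triangle_f.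
have [a1 a2 a3] := @mksiteE N 0 0 0 isT isT isT.
have [b1 b2 b3] := @mksiteE N 1 0 0 N0 isT isT.
have [c1 c2 c3] := @mksiteE N 1 0 1 N0 isT N0.
apply: axis_ind; rewrite !mxE ?x1 ?x2 ?x3 summxE !big_cons big_nil !mxE
  ?a1 ?a2 ?a3 ?b1 ?b2 ?b3 ?c1 ?c2 ?c3; lra.
Qed.

Lemma end_face_centre x : end_face x -> centre (triangle_f' N) = node x.
Proof.
move=> /and3P[/eqP x1 /eqP x2 /eqP x3]; apply/rowP; rewrite /centre /triangle_f'.
have [a1 a2 a3] := @mksiteE N N N N (leqnn _) (leqnn _) (leqnn _).
have [b1 b2 b3] := @mksiteE N N N.-1 N (leqnn _) (leq_pred _) (leqnn _).
have [c1 c2 c3] := @mksiteE N N N.-1 N.-1 (leqnn _) (leq_pred _) (leq_pred _).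
have y2 : bary x axis2 = (N + N.-1 + N.-1)%N by lia.
have y3 : bary x axis3 = (N + N + N.-1)%N by lia.
apply: axis_ind; rewrite !mxE ?x1 ?y2 ?y3 summxE !big_cons big_nil !mxE
  ?a1 ?a2 ?a3 ?b1 ?b2 ?b3 ?c1 ?c2 ?c3 !(natrD, natrM); lra.
Qed.

Lemma three_colour_segmentP (a b : 'rV[R]_3) : three_colour_segment col a b <->
  exists x, [/\ tricoloured col x, a = node x & b = node (sigma col x)].
Proof.
split=> [[k [rho [m [m' [mm' tm tm' -> ->]]]]]|[x [tx -> ->]]].
  exists (k, rho, m); rewrite -[face k rho m]/(face (k, rho, m).1.1 _ (k, rho, m).2) centre_node.
  rewrite -[face k rho m']/(face (k, rho, m').1.1 _ (k, rho, m').2) centre_node; split=> //.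
  have : same_tetra col (k, rho, m) (k, rho, m').
    by apply/orP; right; rewrite eqxx /= /tricoloured tm tm'.
  by case/same_tetra_cases => [[mE]|->] //; rewrite mE eqxx in mm'.
have sx := sigma_tetra col x; have tsx := tricoloured_sigma tx.
exists x.1.1, x.1.2, x.2, (sigma col x).2; split=> //.
- have := sigma_neq tx; apply: contra => /eqP m.
  by rewrite [sigma col x]surjective_pairing sx -m -surjective_pairing.
- by move: tsx; rewrite /tricoloured sx.
- by rewrite centre_node.
- by rewrite -centre_node sx.
Qed.

(** For uniqueness, a line that starts at f has no choice: at each node it goes on along the walk or
    turns back, and turning back repeats a segment. *)
Lemma walk_line L : (0 < L)%N -> end_face (walk L) ->
  (forall i j, (i <= L)%N -> (j <= L)%N -> same_bary (walk i) (walk j) -> i = j) ->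
  unique (@line_from_f_to_f' R N col) (mkseq (fun i => node (walk i)) L.+1).
Proof.
move=> L0 eL wB; set p := mkseq _ _.
have szp : size p = L.+1 by rewrite size_mkseq.
have pE i : (i <= L)%N -> p`_i = node (walk i) by move=> iL; rewrite nth_mkseq.
have lastp : last 0 p = node (walk L) by rewrite (last_nth 0) szp /= -[nth _ _ _]/(p`_L) pE.
have headp : head 0 p = node (walk 0) by [].
have onb x i : bary x i = 0%N \/ bary x i = (3 * N)%N -> cube_boundary N (node x : 'rV[R]_3).
  move=> xi; apply: (cube_boundaryI (i := i)) => [a|].
    rewrite mxE divr_ge0 ?ler0n //= ler_pdivrMr // -natrM ler_nat /bary.
    by have := ltn_ord (x.1.1 a); have := rank_lt3 x.1.2 a; lia.
  by case: xi => xi; [left|right]; rewrite mxE xi ?mul0r // natrM mulrC mulKf.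
split.
  split; last 2 first.
  - by rewrite headp (start_face_centre start_walk).
  - by rewrite lastp (end_face_centre eL).
  split; first by rewrite szp.
  - move=> i; rewrite szp ltnS => iL; apply/three_colour_segmentP.
    exists (walk i); split; [exact: tricoloured_walk|by rewrite pE // ltnW|].
    by rewrite pE // -[walk i.+1]/(tau (sigma col (walk i))) node_tau.
  - move=> i j ij; rewrite szp ltnS => jL E.
    have : [set p`_j; p`_j.+1] p`_i by rewrite -E; left.
    by case; rewrite !pE ?(ltnW jL) // ?(ltnW (ltn_trans ij jL)) // => /node_inj/wB; lia.
  - right; rewrite headp lastp; split.
      have /and3P[_ /eqP s2 _] := start_walk.
      by apply: (onb _ axis2); left.
    have /and3P[/eqP s1 _ _] := eL.
    by apply: (onb _ axis1); right.
move=> q [[szq segq disq _]]; rewrite (start_face_centre start_walk) (end_face_centre eL).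
move=> headq lastq.
(* A node belongs to at most two flags, [walk i] and [tau (walk i)]; their [sigma] partners have the
   next and the previous node of the walk as centres. At both ends the two flags coincide. *)
have step i : (i.+1 < size q)%N -> (i <= L)%N -> q`_i = node (walk i) ->
    (q`_i.+1 = node (walk i.+1) /\ (i < L)%N) \/
    ((0 < i)%N /\ q`_i.+1 = node (walk i.-1)).
  move=> iq iL qi; have /three_colour_segmentP[x [tx qix ->]] := segq _ iq.
  have : same_bary (walk i) x by apply/node_inj; rewrite -qi.
  have back : (0 < i)%N -> tau (walk i) = sigma col (walk i.-1).
    by case: (i) => // i' _; rewrite -[walk i'.+1]/(tau _) tauK.
  have tauL : tau (walk L) = walk L.
    by have /and3P[/eqP e1 _ _] := eL; apply: (boundary_tau (i := axis1)); right.
  case/same_bary_cases => ->.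
    move: iL; rewrite leq_eqVlt => /orP[/eqP iL|iL].
      right; have i0 : (0 < i)%N by rewrite iL.
      by split=> //; rewrite iL -tauL -iL back // sigmaK.
    by left; rewrite -(node_tau (sigma col (walk i))).
  have [i0|i0] := posnP i.
    have t0 : tau (walk 0) = walk 0.
      by have /and3P[_ /eqP e1 _] := start_walk; apply: (boundary_tau (i := axis2)); left.
    by left; rewrite i0 t0 -(node_tau (sigma col (walk 0))).
  by right; split=> //; rewrite back // sigmaK.
have qE i : (i < size q)%N -> (i <= L)%N /\ q`_i = node (walk i).
  elim/ltn_ind: i => -[|i] IH iq; first by rewrite nth0 headq.
  have [iL qi] := IH i (ltnSn i) (ltnW iq).
  have [[-> iL']|[i0 qi1]] := step i iq iL qi; first by [].
  have [_ qi'] : (i.-1 <= L)%N /\ q`_i.-1 = node (walk i.-1).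
    by apply: IH; [lia|apply: leq_ltn_trans (ltnW iq); lia].
  (* Here [q] returns from node [i] to node [i.-1], from which it had come. *)
  exfalso; apply: (disq i.-1 i); rewrite ?prednK //.
  by rewrite qi' qi1 setUC.
have sq : (size q).-1.+1 = size q by rewrite prednK // (ltn_trans _ szq).
have [qL qlast] := qE (size q).-1 ltac:(by rewrite sq).
(* The last node of [q] is the centre of f', which the walk reaches at step [L] only. *)
have eqL : (size q).-1 = L.
  by apply: wB => //; apply/node_inj; rewrite -qlast nth_last.
apply: (@eq_from_nth _ 0); first by rewrite szp -sq eqL.
by move=> i; rewrite szp => iL; rewrite pE // (qE i _).2 // -sq eqL.
Qed.

(** The interior of a Kuhn tetrahedron. Open tetrahedra are disjoint, contain no node, and each open
    segment of the line is inside one of them; injectivity of the polygon follows. *)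
Definition in_open_tetra (c : cell N * 'S_3) (z : 'rV[R]_3) :=
  (forall a, (c.1 a)%:R < z ord0 a < (c.1 a)%:R + 1) /\
  (forall a b, (rank c.2 a < rank c.2 b)%N ->
    z ord0 a - (c.1 a)%:R < z ord0 b - (c.1 b)%:R).

Lemma open_tetra_inj c c' z : in_open_tetra c z -> in_open_tetra c' z -> c = c'.
Proof.
case: c c' => [k rho] [k' rho'] [/= kz rz] [/= kz' rz'].
have kk a : (k a : nat) = k' a.
  have /andP[lo hi] := kz a; have /andP[lo' hi'] := kz' a.
  have := lt_trans lo hi'; have := lt_trans lo' hi.
  by rewrite !natr1 !ltr_nat; lia.
congr (_, _); first by apply/ffunP => a; apply/val_inj/kk.
have rr a b : (rank rho a < rank rho b)%N -> (rank rho' a < rank rho' b)%N.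
  move=> /rz ab; rewrite ltnNge; apply/negP; rewrite leq_eqVlt => /orP[/eqP/rank_inj ba|/rz'].
    by move: ab; rewrite ba ltxx.
  by rewrite -!kk => /(lt_trans ab); rewrite ltxx.
apply: eq_rank.
case: (rankP rho) => r1 r2 r3 r12 [r13 r23].
case: (rankP rho') => s1 s2 s3 s12 [s13 s23].
have := rr axis1 axis2; have := rr axis2 axis1; have := rr axis1 axis3.
have := rr axis3 axis1; have := rr axis2 axis3; have := rr axis3 axis2.
move: r1 r2 r3 r12 r13 r23 s1 s2 s3 s12 s13 s23; clear => *.
have [h1 [h2 h3]] : rank rho axis1 = rank rho' axis1 /\ rank rho axis2 = rank rho' axis2
  /\ rank rho axis3 = rank rho' axis3 by lia.
exact: axis_ind.
Qed.

(** Three times the local coordinates would be three strictly increasing integers strictly between 0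
    and 3. *)
Lemma node_not_in_tetra c x : ~ in_open_tetra c (node x).
Proof.
case: c => k rho [/= kz rz].
have kx a : (3 * k a < bary x a < 3 * k a + 3)%N.
  have := kz a; rewrite mxE ltr_pdivlMr ?ltr_pdivrMr // natr1 -!natrM !ltr_nat; lia.
have rx a b : (rank rho a < rank rho b)%N -> (bary x a - 3 * k a < bary x b - 3 * k b)%N.
  move=> /rz; rewrite !mxE -(ltr_pM2r (ltr0n R 3)) !mulrBl !divfK // => ab.
  have /andP[/ltnW ka _] := kx a; have /andP[/ltnW kb _] := kx b.
  by rewrite -(ltr_nat R) !natrB // !natrM !(mulrC 3%:R).
have := rx (rho (inord 0)) (rho (inord 1)); have := rx (rho (inord 1)) (rho (inord 2)).
rewrite !rank_perm !inordK // => /(_ isT) h1 /(_ isT) h2.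
have := kx (rho (inord 0)); have := kx (rho (inord 2)); have := kx (rho (inord 1)); lia.
Qed.

(** Let m and m' be the indices of the two faces. A point of the segment has local coordinate (r +
    (1 - s)[r < m] + s[r < m']) / 3 on the axis of rank r. It could be 0 only if m = m' = 0, be 1
    only if m = m' = 3, and agree for ranks r and r + 1 only if m = m' = r + 1; but m and m'
    differ. *)
Lemma segment_in_tetra x s : tricoloured col x -> 0 < s < 1 ->
  in_open_tetra x.1 ((1 - s) *: node x + s *: node (sigma col x)).
Proof.
move=> tx /andP[s0 s1]; have sx := sigma_tetra col x.
have mm : (x.2 : nat) <> (sigma col x).2.
  move=> /val_inj m; have := sigma_neq tx.
  by rewrite [sigma col x]surjective_pairing sx -m -surjective_pairing eqxx.
have coordE a : ((1 - s) *: node x + s *: node (sigma col x)) ord0 a - (x.1.1 a)%:R =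
    ((rank x.1.2 a)%:R + (1 - s) * (rank x.1.2 a < x.2)%:R
      + s * (rank x.1.2 a < (sigma col x).2)%:R) / 3.
  have baryE y : (bary y a)%:R = 3 * (y.1.1 a)%:R + (rank y.1.2 a)%:R + (rank y.1.2 a < y.2)%:R :> R.
    by rewrite natrD natrD natrM.
  by rewrite !mxE !baryE sx; field.
have mx := ltn_ord x.2; have my := ltn_ord (sigma col x).2.
split=> [a|a b ab].
  have r3 := rank_lt3 x.1.2 a.
  rewrite -subr_gt0 -[_ < _ + 1]subr_gt0.
  have -> (u v : R) : v + 1 - u = 1 - (u - v) by ring.
  rewrite coordE.
  have lo : rank x.1.2 a = 0%N ->
      (rank x.1.2 a < x.2)%N || (rank x.1.2 a < (sigma col x).2)%N by lia.
  have hi : rank x.1.2 a = 2%N ->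
      ~~ ((rank x.1.2 a < x.2)%N && (rank x.1.2 a < (sigma col x).2)%N) by lia.
  move: (rank x.1.2 a < x.2)%N (rank x.1.2 a < (sigma col x).2)%N lo hi s0 s1 => u v.
  case: (rank x.1.2 a) r3 => [|[|[|r]]] // _ lo hi; [have := lo erefl| |have := hi erefl];
    by clear; case: u; case: v => //= *; rewrite ?mulr1 ?mulr0; apply/andP; lra.
rewrite !coordE ltr_pM2r ?invr_gt0 ?ltr0n //.
have [ab2|ab2] := leqP (rank x.1.2 a).+2 (rank x.1.2 b).
  move: ab2; rewrite -(ler_nat R) -natr1 -natr1 => ab2.
  move: (_ a)%:R (_ b)%:R ab2 s0 s1 => ra rb; clear.
  by do 4!case: (_ < _)%N; rewrite /= ?mulr1 ?mulr0; lra.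
have E : rank x.1.2 b = (rank x.1.2 a).+1 by lia.
have : ~~ [&& rank x.1.2 a < x.2, rank x.1.2 a < (sigma col x).2,
    ~~ (rank x.1.2 b < x.2) & ~~ (rank x.1.2 b < (sigma col x).2)]%N by lia.
rewrite E -natr1; move: (_ a)%:R s0 s1 => ra; clear.
by do 4!case: (_ < _)%N; rewrite //= ?mulr1 ?mulr0 => *; lra.
Qed.

Variable L : nat.
Hypotheses (L0 : (0 < L)%N) (eL : end_face (walk L)).
Hypothesis wB : forall i j,
  (i <= L)%N -> (j <= L)%N -> same_bary (walk i) (walk j) -> i = j.
Hypothesis wT : forall i j, (i < L)%N -> (j < L)%N -> (walk i).1 = (walk j).1 -> i = j.

Definition line := mkseq (fun i => node (walk i)) L.+1.

Lemma line_nth i : (i <= L)%N -> line`_i = node (walk i).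
Proof. by move=> iL; rewrite nth_mkseq. Qed.

Lemma line_point t : 0 <= t <= L%:R ->
  (exists2 i : nat, (i <= L)%N & t = i%:R) \/
  (exists i : nat, [/\ (i < L)%N, 0 < t - i%:R < 1
     & in_open_tetra (walk i).1 (polygon line t)]).
Proof.
move=> /andP[t0 tL]; have /andP[le_t lt_t] := truncn_itv t0.
have iL : (Num.truncn t <= L)%N by rewrite -(ler_nat R) (le_trans le_t).
move: le_t; rewrite le_eqVlt => /orP[/eqP tE|lt_t'].
  by left; exists (Num.truncn t).
have iL' : (Num.truncn t < L)%N by rewrite -(ltr_nat R) (lt_le_trans lt_t').
right; exists (Num.truncn t); split=> //.
  by rewrite subr_gt0 lt_t' /= ltrBlDl natr1.
rewrite (@polygonE _ _ (Num.truncn t)) ?(ltW lt_t') ?(ltW lt_t) //.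
rewrite !line_nth // -[walk _.+1]/(tau (sigma col (walk _))) node_tau.
apply: segment_in_tetra (tricoloured_walk _) _.
by rewrite subr_gt0 lt_t' /= ltrBlDl natr1.
Qed.

Lemma line_inj t u : 0 <= t <= L%:R -> 0 <= u <= L%:R ->
  polygon line t = polygon line u -> t = u.
Proof.
move=> tL uL E.
have [[i iL ti]|[i [iL ti it]]] := line_point tL; have [[j jL uj]|[j [jL uj ju]]] := line_point uL.
- move: E; rewrite ti uj !polygon_nat !line_nth // => /node_inj ij.
  by rewrite (wB iL jL ij).
- by exfalso; move: ju; rewrite -E ti polygon_nat line_nth //; apply: node_not_in_tetra.
- by exfalso; move: it; rewrite E uj polygon_nat line_nth //; apply: node_not_in_tetra.
(* A common point of two open tetrahedra makes them equal, hence also the two segments; such a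
   segment has distinct ends. *)
rewrite E in it; have ij := wT iL jL (open_tetra_inj it ju); subst j.
have n01 : node (walk i.+1) - node (walk i) != 0.
  rewrite subr_eq0; apply/eqP => /node_inj/wB.
  by move=> /(_ iL (ltnW iL)) /eqP; rewrite gtn_eqF.
move: E; rewrite !(@polygonE _ _ i) ?line_nth ?(ltnW iL) //; last 2 first.
- by rewrite -natr1; lra.
- by rewrite -natr1; lra.
have comb (s : R) : (1 - s) *: node (walk i) + s *: node (walk i.+1) =
    node (walk i) + s *: (node (walk i.+1) - node (walk i)).
  by apply/rowP => a; rewrite !mxE; ring.
rewrite !comb => /addrI /eqP; rewrite -subr_eq0 -scalerBl scaler_eq0 (negPf n01) orbF.
by rewrite opprB addrA subrK subr_eq0 => /eqP.
Qed.

Lemma line_inside t a : 0 < t < L%:R -> 0 < polygon line t ord0 a < N%:R.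
Proof.
move=> /andP[t0 tL].
have [|[i iL ti]|[i [iL ti [/(_ a) /andP[lo hi] _]]]] := @line_point t.
- by rewrite !ltW.
- rewrite ti polygon_nat line_nth // mxE.
  have : (0 < bary (walk i) a < 3 * N)%N.
    apply: (walk_inside eL wB); move: t0 tL; rewrite ti ltr0n ltr_nat => -> //.
  by move=> /andP[b0 bN]; rewrite divr_gt0 ?ltr0n //= ltr_pdivrMr // -natrM ltr_nat mulnC.
rewrite (le_lt_trans _ lo) ?ler0n //= (lt_le_trans hi) // natr1 ler_nat.
exact: ltn_ord.
Qed.

End Walk.

(** * Isotopies of loops *)

Section Isotopy.
Context {R : realType}.
Implicit Types (g : R -> 'rV[R]_3) (t s : R) (H : R * R -> 'rV[R]_3).

(** Precomposing with this retraction onto [0, 1] turns continuity within the interval into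
    continuity everywhere. *)
Definition clamp t : R := Num.max 0 (Num.min t 1).

Lemma clamp_itv t : clamp t \in `[(0 : R), 1].
Proof. by rewrite in_itv /= /clamp le_max lexx /= ge_max ler01 /= ge_min lexx orbT. Qed.

Lemma clamp_id t : 0 <= t <= 1 -> clamp t = t.
Proof. by move=> /andP[t0 t1]; rewrite /clamp min_l // max_r. Qed.

Lemma clamp0 t : t <= 0 -> clamp t = 0.
Proof. by move=> t0; rewrite /clamp min_l ?max_l // (le_trans t0). Qed.

Lemma clamp1 t : 1 <= t -> clamp t = 1.
Proof. by move=> t1; rewrite /clamp min_r // max_r. Qed.

Lemma clamp_continuous : continuous clamp.
Proof.
move=> t; apply: (@continuous_max R R (cst 0) (fun t => Num.min t 1)).
  exact: cvg_cst.
by apply: (@continuous_min R R id (cst 1)); [exact: cvg_id|exact: cvg_cst].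
Qed.

Section Continuous.
Context {T : topologicalType} {V : normedModType R}.

Lemma continuous_cst (W : topologicalType) (c : W) : continuous ((fun=> c) : T -> W).
Proof. by move=> x; apply: cvg_cst. Qed.

Lemma continuous_comp2 (U W : topologicalType) (f : T -> U) (g : U -> W) :
  continuous f -> continuous g -> continuous (fun x => g (f x)).
Proof. by move=> fc gc x; apply: continuous_comp; [apply: fc|apply: gc]. Qed.

Lemma continuous_pair (U W : topologicalType) (f : T -> U) (g : T -> W) :
  continuous f -> continuous g -> continuous (fun x => (f x, g x)).
Proof. by move=> fc gc x; apply: (cvg_pair (fc x) (gc x)). Qed.

Lemma continuous_add (f g : T -> V) :
  continuous f -> continuous g -> continuous (fun x => f x + g x).
Proof. by move=> fc gc x; apply: cvgD; [apply: fc|apply: gc]. Qed.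

Lemma continuous_sub (f g : T -> V) :
  continuous f -> continuous g -> continuous (fun x => f x - g x).
Proof. by move=> fc gc x; apply: cvgB; [apply: fc|apply: gc]. Qed.

Lemma continuous_scale (f : T -> R) (g : T -> V) :
  continuous f -> continuous g -> continuous (fun x => f x *: g x).
Proof. by move=> fc gc x; apply: cvgZ; [apply: fc|apply: gc]. Qed.

Lemma continuous_addr (f g : T -> R) :
  continuous f -> continuous g -> continuous (fun x => f x + g x).
Proof. by move=> fc gc x; apply: cvgD; [apply: fc|apply: gc]. Qed.

Lemma continuous_subr (f g : T -> R) :
  continuous f -> continuous g -> continuous (fun x => f x - g x).
Proof. by move=> fc gc x; apply: cvgB; [apply: fc|apply: gc]. Qed.

Lemma continuous_mulr (f g : T -> R) :
  continuous f -> continuous g -> continuous (fun x => f x * g x).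
Proof. by move=> fc gc x; apply: cvgM; [apply: fc|apply: gc]. Qed.

Lemma continuous_clamp (f : T -> R) :
  continuous f -> continuous (fun x => clamp (f x)).
Proof. by move=> fc; apply: (continuous_comp2 fc clamp_continuous). Qed.

End Continuous.

Lemma continuous_fst (T U : topologicalType) : continuous (fun x : T * U => x.1).
Proof. by move=> x; apply: cvg_fst. Qed.

Lemma continuous_snd (T U : topologicalType) : continuous (fun x : T * U => x.2).
Proof. by move=> x; apply: cvg_snd. Qed.

Lemma continuous_retract (T W : topologicalType) (A : set T) (f : T -> W) (c : T -> T) :
  continuous c -> (forall x, A (c x)) -> {within A, continuous f} -> continuous (f \o c).
Proof.
move=> cc Ac /subspace_continuousP fA x U /= /(fA _ (Ac x)) fU.
have cfU : \forall y \near x, A (c y) -> U (f (c y)) := cc x _ fU.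
change (\forall y \near x, U (f (c y))).
by apply: filterS cfU => y; apply; apply: Ac.
Qed.

Lemma within_continuous_eq (T W : topologicalType) (A : set T) (f F : T -> W) :
  continuous F -> (forall x, A x -> F x = f x) -> {within A, continuous f}.
Proof.
move=> Fc Ff; apply/subspace_continuousP => x Ax U /= fU.
have FU : \forall y \near x, U (F y) by apply: Fc; rewrite Ff.
change (\forall y \near x, A y -> U (f y)).
by apply: filterS FU => y Uy Ay; rewrite -Ff.
Qed.

Lemma ray_continuous g :
  (forall t, ray_affine g t 1) -> (forall t, ray_affine g t (-1)) -> continuous g.
Proof.
move=> gr gl t; have [d d0 [v gv]] := gr t; have [d' d'0 [v' gv']] := gl t.
apply/cvgrPdist_lt => e e0.
(* Bounds both slopes; the summand 1 keeps it positive. *)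
pose M := 1 + `|v| + `|v'|.
have M0 : 0 < M by rewrite /M -addrA ltr_wpDr // addr_ge0.
have r0 : 0 < Num.min d (Num.min d' (e / M)) by rewrite !lt_min d0 d'0 divr_gt0.
near=> y.
have : `|t - y| < Num.min d (Num.min d' (e / M)).
  by near: y; exact: (nbhsx_ballx t _ r0).
rewrite !lt_min ltr_pdivlMr // => /and3P[yd yd' ye].
have small s w : `|s| = `|t - y| -> `|w| <= M -> `|g t - (g t + s *: w)| < e.
  move=> sE wM; rewrite opprD addrA subrr sub0r normrN normrZ sE.
  by apply: le_lt_trans ye; rewrite ler_wpM2l.
have [ty|/ltW yt] := leP t y.
  have sE : `|y - t| = `|t - y| by rewrite distrC.
  have := gv (y - t); rewrite mulr1 (addrC t (y - t)) subrK => ->.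
    by apply: small => //; rewrite /M; have := normr_ge0 v'; lra.
  by rewrite subr_ge0 ty -[y - t]ger0_norm ?subr_ge0 // sE ltW.
have := gv' (t - y); rewrite mulrN1 opprB (addrC t (y - t)) subrK => ->.
  by apply: small => //; rewrite /M; have := normr_ge0 v; lra.
by rewrite subr_ge0 yt -[t - y]ger0_norm ?subr_ge0 // ltW.
Unshelve. all: by end_near.
Qed.

Lemma locally_affine_continuous g : locally_affine g -> continuous (g \o clamp).
Proof.
have cst u e t d : 0 < d -> (forall s, 0 <= s <= d -> clamp (t + s * e) = u) ->
    ray_affine (g \o clamp) t e.
  move=> d0 E; exists d => //; exists 0 => s sd.
  have t_u : clamp t = u by rewrite -[t]addr0 -(mul0r e) E // lexx ltW.
  by rewrite /= E // t_u scaler0 addr0.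
move=> [gr gl]; apply: ray_continuous => t.
  have [t0|t0] := ltP t 0.
    by apply: (cst 0 _ _ (- t)) => [|s]; rewrite ?oppr_gt0 // mulr1 => ?; rewrite clamp0 //; lra.
  have [t1|t1] := ltP t 1; last first.
    by apply: (cst 1 _ _ 1) => // s; rewrite mulr1 => ?; rewrite clamp1 //; lra.
  apply: (ray_affine_eq (d := 1 - t)) (gr t _) => [|s|]; rewrite ?subr_gt0 ?t0 // mulr1 => st.
  by rewrite /= clamp_id //; lra.
have [t0|t0] := leP t 0.
  by apply: (cst 0 _ _ 1) => // s; rewrite mulrN1 => ?; rewrite clamp0 //; lra.
have [t1|t1] := leP t 1; last first.
  by apply: (cst 1 _ _ (t - 1)) => [|s]; rewrite ?subr_gt0 // mulrN1 => ?; rewrite clamp1 //; lra.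
apply: (ray_affine_eq (d := t)) (gl t _) => [|s|]; rewrite ?t0 // mulrN1 => st.
by rewrite /= clamp_id //; lra.
Qed.

(** [knot_equiv] with continuity on the whole plane, which composes freely; [clamp] shows that
    nothing is lost. *)
Definition isotopy H g0 g1 := [/\ continuous H,
  forall t, t \in `[(0 : R), 1] -> H (t, 0) = g0 t,
  forall t, t \in `[(0 : R), 1] -> H (t, 1) = g1 t
  & forall s, s \in `[(0 : R), 1] ->
      H (0, s) = H (1, s) /\ {in `[(0 : R), 1[ &, injective (fun t => H (t, s))}].

Lemma isotopy_knot_equiv H g0 g1 : isotopy H g0 g1 -> knot_equiv g0 g1.
Proof.
by move=> [Hc H0 H1 HI]; exists H; split=> //; apply: continuous_subspaceT.
Qed.

Lemma knot_equiv_isotopy g0 g1 : knot_equiv g0 g1 -> exists H, isotopy H g0 g1.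
Proof.
move=> [h [hc h0 h1 hI]]; exists (fun x => h (clamp x.1, clamp x.2)).
have itv1 t : t \in `[(0 : R), 1[ -> t \in `[(0 : R), 1].
  by rewrite !in_itv /= => /andP[-> /ltW].
have cl t : t \in `[(0 : R), 1] -> clamp t = t by rewrite in_itv /= => /clamp_id.
have m0 : (0 : R) \in `[(0 : R), 1] by rewrite in_itv /= lexx ler01.
have m1 : (1 : R) \in `[(0 : R), 1] by rewrite in_itv /= lexx ler01.
split=> [|t t01|t t01|s s01].
- apply: (@continuous_retract _ _ _ h (fun x => (clamp x.1, clamp x.2)) _ _ hc) => [|[t s]]; last by split; exact: clamp_itv.
  by apply: continuous_pair; apply: continuous_clamp; [exact: continuous_fst|exact: continuous_snd].
- by rewrite /= !cl ?h0.
- by rewrite /= !cl ?h1.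
have [hs hi] := hI s s01; rewrite /= !cl //; split=> // t u t01 u01.
by rewrite !(cl t, cl u) ?itv1 //; apply: hi.
Qed.

Lemma knot_equiv_sym g0 g1 : knot_equiv g0 g1 -> knot_equiv g1 g0.
Proof.
move=> /knot_equiv_isotopy[H [Hc H0 H1 HI]].
apply: (@isotopy_knot_equiv (fun x => H (x.1, 1 - x.2))); split=> [|t t01|t t01|s].
- apply: (@continuous_comp2 _ _ _ (fun x : R * R => (x.1, 1 - x.2)) H) => //.
  apply: continuous_pair; first exact: continuous_fst.
  by apply: continuous_subr; [exact: continuous_cst|exact: continuous_snd].
- by rewrite /= subr0 H1.
- by rewrite /= subrr H0.
by rewrite in_itv /= => s01; apply: HI; rewrite in_itv /=; lra.
Qed.

Lemma knot_equiv_trans g1 g0 g2 : knot_equiv g0 g1 -> knot_equiv g1 g2 -> knot_equiv g0 g2.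
Proof.
move=> /knot_equiv_isotopy[H [Hc H0 H1 HI]] /knot_equiv_isotopy[K [Kc K0 K1 KI]].
(* Concatenation written as a sum: for times up to 1/2 the last two terms cancel, from 1/2 on the
   first and the last do. Continuity then needs no pasting. *)
pose G x := H (x.1, clamp (2 * x.2)) + K (x.1, clamp (2 * x.2 - 1)) - H (x.1, 1).
have itv1 t : t \in `[(0 : R), 1[ -> t \in `[(0 : R), 1].
  by rewrite !in_itv /= => /andP[-> /ltW].
have m0 : (0 : R) \in `[(0 : R), 1] by rewrite in_itv /= lexx ler01.
have m1 : (1 : R) \in `[(0 : R), 1] by rewrite in_itv /= lexx ler01.
have Gl t s : t \in `[(0 : R), 1] -> s <= 2^-1 -> G (t, s) = H (t, clamp (2 * s)).
  move=> t01 s2; rewrite /G /= (@clamp0 (2 * s - 1)); last by lra.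
  by rewrite K0 // H1 // addrK.
have Gr t s : t \in `[(0 : R), 1] -> 2^-1 <= s -> G (t, s) = K (t, clamp (2 * s - 1)).
  move=> t01 s2; rewrite /G /= (@clamp1 (2 * s)); last by lra.
  by rewrite addrAC subrr add0r.
apply: (@isotopy_knot_equiv G); split=> [|t t01|t t01|s s01].
- have c2 : continuous (fun x : R * R => 2 * x.2).
    by apply: continuous_mulr; [exact: continuous_cst|exact: continuous_snd].
  have c21 : continuous (fun x : R * R => 2 * x.2 - 1).
    by apply: continuous_subr => //; exact: continuous_cst.
  apply: continuous_sub; first apply: continuous_add.
  + apply: (continuous_comp2 _ Hc); apply: continuous_pair; first exact: continuous_fst.
    exact: continuous_clamp.
  + apply: (continuous_comp2 _ Kc); apply: continuous_pair; first exact: continuous_fst.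
    exact: continuous_clamp.
  + apply: (continuous_comp2 _ Hc).
    by apply: continuous_pair; [exact: continuous_fst|exact: continuous_cst].
- by rewrite Gl ?mulr0 ?clamp0 ?H0 // invr_ge0.
- by rewrite Gr // ?clamp1 ?K1 //; lra.
have [s2|s2] := leP s 2^-1.
  rewrite !Gl //; have [-> inj] := HI _ (clamp_itv (2 * s)); split=> // t u t01 u01 /=.
  by rewrite !Gl ?itv1 //; apply: inj.
rewrite !Gr ?(ltW s2) //; have [-> inj] := KI _ (clamp_itv (2 * s - 1)); split=> // t u t01 u01 /=.
by rewrite !Gr ?itv1 ?(ltW s2) //; apply: inj.
Qed.

Lemma knot_class_eq g0 g1 : knot_equiv g0 g1 -> knot_class g0 = knot_class g1.
Proof.
move=> g01; apply/seteqP; split=> g [gs geq]; split=> //.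
  exact: knot_equiv_trans (knot_equiv_sym g01) geq.
exact: knot_equiv_trans g01 geq.
Qed.

End Isotopy.

(** * Planar quadrilaterals are all equivalent *)

Section Quadrilateral.
Context {R : realType}.
Implicit Types (c d e : 'rV[R]_3) (t s : R).

(** For a = 0, ..., 3, the progress made along the quarter [a/4, (a + 1)/4]. Combinations of ramps
    are piecewise affine functions with evident continuity. *)
Definition ramp (a t : R) : R := clamp (4 * t - a).
Definition quadX t := ramp 0 t - ramp 1 t - ramp 2 t + ramp 3 t.
Definition quadY t := ramp 1 t - ramp 2 t.

(* The quadrilateral with vertices c, c + d, c + e, c - d, at times 0, 1/4, 1/2, 3/4. *)
Definition quad c d e t := c + quadX t *: d + quadY t *: e.

Definition quad_spec t (x y : R) :=
  [\/ [/\ t <= 4^-1, x = 4 * t & y = 0],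
      [/\ 4^-1 <= t <= 2^-1, x = 2 - 4 * t & y = 4 * t - 1],
      [/\ 2^-1 <= t <= 3 / 4, x = 2 - 4 * t & y = 3 - 4 * t]
    | [/\ 3 / 4 <= t, x = 4 * t - 4 & y = 0]].

Lemma quadP t : 0 <= t <= 1 -> quad_spec t (quadX t) (quadY t).
Proof.
rewrite /quadX /quadY /ramp => t01.
have [t0|t0] := leP t 4^-1.
  have -> : clamp (4 * t - 0) = 4 * t - 0 by apply: clamp_id; lra.
  have -> : clamp (4 * t - 1) = 0 by apply: clamp0; lra.
  have -> : clamp (4 * t - 2) = 0 by apply: clamp0; lra.
  have -> : clamp (4 * t - 3) = 0 by apply: clamp0; lra.
  by constructor 1; split; lra.
have [t1|t1] := leP t 2^-1.
  have -> : clamp (4 * t - 0) = 1 by apply: clamp1; lra.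
  have -> : clamp (4 * t - 1) = 4 * t - 1 by apply: clamp_id; lra.
  have -> : clamp (4 * t - 2) = 0 by apply: clamp0; lra.
  have -> : clamp (4 * t - 3) = 0 by apply: clamp0; lra.
  by constructor 2; split; lra.
have [t2|t2] := leP t (3 / 4).
  have -> : clamp (4 * t - 0) = 1 by apply: clamp1; lra.
  have -> : clamp (4 * t - 1) = 1 by apply: clamp1; lra.
  have -> : clamp (4 * t - 2) = 4 * t - 2 by apply: clamp_id; lra.
  have -> : clamp (4 * t - 3) = 0 by apply: clamp0; lra.
  by constructor 3; split; lra.
have -> : clamp (4 * t - 0) = 1 by apply: clamp1; lra.
have -> : clamp (4 * t - 1) = 1 by apply: clamp1; lra.
have -> : clamp (4 * t - 2) = 1 by apply: clamp1; lra.
have -> : clamp (4 * t - 3) = 4 * t - 3 by apply: clamp_id; lra.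
by constructor 4; split; lra.
Qed.

Lemma quadXY_inj t u : 0 <= t < 1 -> 0 <= u < 1 ->
  quadX t = quadX u -> quadY t = quadY u -> t = u.
Proof.
move=> t01 u01.
have := @quadP t ltac:(lra); have := @quadP u ltac:(lra).
by case=> [] [? ? ?]; case=> [] [? ? ?]; lra.
Qed.

Lemma ramp_continuous a : continuous (ramp a).
Proof.
apply: continuous_clamp; apply: continuous_subr; last exact: continuous_cst.
by apply: continuous_mulr; [exact: continuous_cst|move=> x; exact: cvg_id].
Qed.

Lemma quadX_continuous : continuous quadX.
Proof.
by apply: continuous_addr; [apply: continuous_subr; [apply: continuous_subr|]|]; apply: ramp_continuous.
Qed.

Lemma quadY_continuous : continuous quadY.
Proof. by apply: continuous_subr; apply: ramp_continuous. Qed.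

Definition indep2 d e := forall x y : R, x *: d + y *: e = 0 -> x = 0 /\ y = 0.

Definition indep3 d e f := forall x y z : R,
  x *: d + y *: e + z *: f = 0 -> [/\ x = 0, y = 0 & z = 0].

Lemma quad0 c d e : quad c d e 0 = c.
Proof.
have [X0 Y0] : quadX 0 = 0 :> R /\ quadY 0 = 0 :> R.
  by have := @quadP 0 ltac:(lra); case=> [] [? ? ?]; lra.
by rewrite /quad X0 Y0 !scale0r !addr0.
Qed.

Lemma quad1 c d e : quad c d e 1 = c.
Proof.
have [X0 Y0] : quadX 1 = 0 :> R /\ quadY 1 = 0 :> R.
  by have := @quadP 1 ltac:(lra); case=> [] [? ? ?]; lra.
by rewrite /quad X0 Y0 !scale0r !addr0.
Qed.

Lemma quad_inj c d e : indep2 d e -> {in `[(0 : R), 1[ &, injective (quad c d e)}.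
Proof.
move=> de t u; rewrite !in_itv /= => t01 u01 /eqP.
rewrite -subr_eq0 => /eqP E; have [|/eqP + /eqP +] := de (quadX t - quadX u) (quadY t - quadY u).
  by rewrite -E /quad; apply/rowP => i; rewrite !mxE; ring.
by rewrite !subr_eq0 => /eqP + /eqP +; apply: quadXY_inj.
Qed.

Lemma quad_continuous c d e : continuous (quad c d e).
Proof.
apply: continuous_add; last first.
  by apply: continuous_scale; [exact: quadY_continuous|exact: continuous_cst].
apply: continuous_add; first exact: continuous_cst.
by apply: continuous_scale; [exact: quadX_continuous|exact: continuous_cst].
Qed.

Lemma quad_simple c d e : indep2 d e -> simple_loop (quad c d e).
Proof.
move=> de; split; last exact: quad_inj.
split; first by apply: continuous_subspaceT; apply: quad_continuous.
by rewrite quad0 quad1.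
Qed.

Definition lin c d s := (1 - s) *: c + s *: d.

Lemma lin_continuous c d : continuous (lin c d).
Proof.
apply: continuous_add; apply: continuous_scale; try exact: continuous_cst.
  by apply: continuous_subr; [exact: continuous_cst|move=> x; exact: cvg_id].
by move=> x; exact: cvg_id.
Qed.

Lemma lin0 c d : lin c d 0 = c.
Proof. by rewrite /lin subr0 scale1r scale0r addr0. Qed.

Lemma lin1 c d : lin c d 1 = d.
Proof. by rewrite /lin subrr scale1r scale0r add0r. Qed.

Lemma quad_lin c d e c' d' e' :
  (forall s, 0 <= s <= 1 -> indep2 (lin d d' s) (lin e e' s)) ->
  knot_equiv (quad c d e) (quad c' d' e').
Proof.
move=> de; apply: (@isotopy_knot_equiv _
  (fun x => quad (lin c c' x.2) (lin d d' x.2) (lin e e' x.2) x.1)).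
have c2 u v : continuous (fun x : R * R => lin u v x.2).
  exact: (continuous_comp2 (@continuous_snd _ _) (@lin_continuous u v)).
split=> [|t _|t _|s]; rewrite /= ?lin0 ?lin1 //.
  apply: continuous_add; first apply: continuous_add => //.
    by apply: continuous_scale => //; exact: (continuous_comp2 (@continuous_fst _ _) quadX_continuous).
  by apply: continuous_scale => //; exact: (continuous_comp2 (@continuous_fst _ _) quadY_continuous).
rewrite in_itv /= => s01; rewrite quad0 quad1; split=> //.
by apply: quad_inj; apply: de.
Qed.

(** On the way from [e] to [e'] the moving vector stays out of the line of [d], because [d], [e],
    [e'] are independent. *)
Lemma quad_change_second c c' d e e' : indep3 d e e' ->
  knot_equiv (quad c d e) (quad c' d e').
Proof.
move=> de; apply: quad_lin => s s01 x y; rewrite /lin -scalerDl subrK scale1r scalerDr !scalerA addrA.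
by move=> /de[-> y1 y2]; split=> //; have := congr2 +%R y1 y2; rewrite addr0 -mulrDr subrK mulr1.
Qed.

Lemma quad_change_first c c' d d' e : indep3 d d' e ->
  knot_equiv (quad c d e) (quad c' d' e).
Proof.
move=> de; apply: quad_lin => s s01 x y.
rewrite /lin -[_ *: e + _]scalerDl subrK scale1r scalerDr !scalerA.
by move=> /de[x1 x2 ->]; split=> //; have := congr2 +%R x1 x2; rewrite addr0 -mulrDr subrK mulr1.
Qed.

Let b (i : 'I_3) : 'rV[R]_3 := delta_mx 0 i.

Lemma indep3_ex d e : indep2 d e -> exists i, indep3 d e (b i).
Proof.
move=> de.
have [i bi] : exists i, ~ (b i <= col_mx d e)%MS.
  (* Otherwise the two rows [d] and [e] would span the whole space, of rank 3. *)
  apply: contrapT => no; have : (1%:M <= col_mx d e)%MS.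
    apply/row_subP => i; rewrite row1; apply: contrapT => bi; apply: no.
    by exists i.
  by move=> /mxrankS; rewrite mxrank1 => /leq_trans /(_ (rank_leq_row _)).
exists i => x y z E; have [z0|z0] := eqVneq z 0.
  by move: E; rewrite z0 scale0r addr0 => /de[-> ->].
case: bi; apply/submxP; exists (row_mx (- (x / z))%:M (- (y / z))%:M).
rewrite mul_row_col !mul_scalar_mx; apply: (scalerI z0).
rewrite scalerDr !scalerA.
have -> : z * - (x / z) = - x by field.
have -> : z * - (y / z) = - y by field.
by rewrite !scaleNr -opprD; apply/eqP; rewrite -addr_eq0 addrC E.
Qed.

Lemma basis_indep3 (i j k : 'I_3) : i != j -> i != k -> j != k -> indep3 (b i) (b j) (b k).
Proof.
move=> ij ik jk x y z /rowP E; have coord l : (x *: b i + y *: b j + z *: b k) ord0 l =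
    x * (l == i)%:R + y * (l == j)%:R + z * (l == k)%:R by rewrite !mxE.
by split; [have := E i|have := E j|have := E k]; rewrite coord mxE !eqxx
  ?(negPf ij) ?(negPf ik) ?(negPf jk) 1?eq_sym ?(negPf ij) ?(negPf ik) ?(negPf jk)
  1?[k == j]eq_sym ?(negPf jk) ?mulr0 ?mulr1 ?addr0 ?add0r.
Qed.

Definition std_quad : R -> 'rV[R]_3 := quad 0 (b axis1) (b axis2).

Lemma basis_indep2 i j : i != j -> indep2 (b i) (b j).
Proof.
move=> ij x y /rowP E; have coord l : (x *: b i + y *: b j) ord0 l =
    x * (l == i)%:R + y * (l == j)%:R by rewrite !mxE.
by split; [have := E i|have := E j]; rewrite coord mxE !eqxx
  ?(negPf ij) 1?eq_sym ?(negPf ij) ?mulr0 ?mulr1 ?addr0 ?add0r.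
Qed.

(** Two axes cannot be exchanged directly by independent replacements; the exchange goes round
    through the third axis, changing one vector at a time and visiting all six ordered pairs. *)
Lemma quad_basis_std i j : i != j -> knot_equiv (quad 0 (b i) (b j)) std_quad.
Proof.
have second (x y z : 'I_3) : x != y -> x != z -> y != z ->
    knot_equiv (quad 0 (b x) (b z)) std_quad -> knot_equiv (quad 0 (b x) (b y)) std_quad.
  by move=> xy xz yz; apply: knot_equiv_trans; apply: quad_change_second; apply: basis_indep3.
have first_ (x y z : 'I_3) : x != y -> x != z -> y != z ->
    knot_equiv (quad 0 (b y) (b z)) std_quad -> knot_equiv (quad 0 (b x) (b z)) std_quad.
  by move=> xy xz yz; apply: knot_equiv_trans; apply: quad_change_first; apply: basis_indep3.
have P01 : knot_equiv (quad 0 (b axis1) (b axis2)) std_quad.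
  apply: quad_lin => s _; rewrite /lin -!scalerDl subrK !scale1r.
  by apply: basis_indep2; rewrite axis_eqE.
have P02 : knot_equiv (quad 0 (b axis1) (b axis3)) std_quad.
  by apply: (second _ _ axis2); rewrite ?axis_eqE.
have P12 : knot_equiv (quad 0 (b axis2) (b axis3)) std_quad.
  by apply: (first_ _ axis1); rewrite ?axis_eqE.
have P10 : knot_equiv (quad 0 (b axis2) (b axis1)) std_quad.
  by apply: (second _ _ axis3); rewrite ?axis_eqE.
have P20 : knot_equiv (quad 0 (b axis3) (b axis1)) std_quad.
  by apply: (first_ _ axis2); rewrite ?axis_eqE.
have P21 : knot_equiv (quad 0 (b axis3) (b axis2)) std_quad.
  by apply: (second _ _ axis1); rewrite ?axis_eqE.
by move: i j; apply: axis_ind; apply: axis_ind; rewrite ?eqxx.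
Qed.

Lemma indep3_swap d e f : indep3 d e f -> indep3 d f e.
Proof. by move=> def x y z; rewrite addrAC => /def[]. Qed.

Lemma indep3_indep2 d e f : indep3 d e f -> indep2 e f.
Proof. by move=> def x y E; have [|_ -> ->] := def 0 x y; rewrite ?scale0r ?add0r. Qed.

(** First [e] is replaced by a basis vector outside the plane of [d] and [e], then [d] by a basis
    vector outside the new plane. *)
Lemma quad_std c d e : indep2 d e -> knot_equiv (quad c d e) std_quad.
Proof.
move=> de; have [i dei] := indep3_ex de.
have di : indep2 d (b i).
  by move=> x y E; have [|-> _ ->] := dei x 0 y; rewrite ?scale0r ?addr0.
have [j dij] := indep3_ex di.
have ij : j != i.
  apply/eqP => ij; have := indep3_indep2 dij; rewrite ij => /(_ 1 (-1)).
  by rewrite scale1r scaleN1r subrr => /(_ erefl) [/eqP]; rewrite oner_eq0.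
apply: knot_equiv_trans (quad_change_second c 0 dei) _.
apply: knot_equiv_trans (quad_change_first 0 0 (indep3_swap dij)) _.
exact: quad_basis_std.
Qed.

Lemma quad_mid_low t : 4^-1 <= t <= 2^-1 -> quadX t = 2 - 4 * t /\ quadY t = 4 * t - 1.
Proof. by move=> t01; have := @quadP t ltac:(lra); case=> [] [? ? ?]; lra. Qed.

Lemma quad_mid_high t : 2^-1 <= t <= 3 / 4 -> quadX t = 2 - 4 * t /\ quadY t = 3 - 4 * t.
Proof. by move=> t01; have := @quadP t ltac:(lra); case=> [] [? ? ?]; lra. Qed.

End Quadrilateral.

(** * The Alexander trick *)

Section Cone.
Context {R : realType}.
Implicit Types (t s : R) (D : R -> 'rV[R]_3).

(* The Alexander trick: D, which vanishes away from 0, is shrunk to 0 with its graph. *)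
Lemma cone_continuous D : continuous D -> (exists M, forall t, `|D t| <= M) ->
  continuous (fun x : R * R => x.2 *: D (x.1 / x.2)).
Proof.
move=> Dc [M DM] [t s]; have [s0|s0] := eqVneq s 0; last first.
  apply: (@cvgZ _ _ (R * R)%type _ _ (fun x : R * R => x.2) (fun x : R * R => D (x.1 / x.2))).
    exact: continuous_snd.
  apply: (@continuous_comp _ _ _ (fun x : R * R => x.1 / x.2) D); last exact: Dc.
  apply: cvgM; first exact: continuous_fst.
  by apply: cvgV => //; exact: continuous_snd.
(* At ratio 0 the value is 0 whatever [t / 0] denotes, and the bound on [D] makes it the limit. *)
rewrite s0 /continuous_at /= scale0r; apply/cvgr0Pnorm_lt => e e0.
have M0 : 0 < `|M| + 1 by rewrite ltr_wpDl.
near=> x; have : `|x.2| < e / (`|M| + 1).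
  near: x; have /cvgr0Pnorm_lt/(_ (e / (`|M| + 1))) := @continuous_snd R R (t, 0).
  by apply; rewrite divr_gt0.
rewrite ltr_pdivlMr // => xe; rewrite normrZ; apply: le_lt_trans xe.
rewrite ler_wpM2l // (le_trans (DM _)) // (le_trans (ler_norm M)) // lerDl ler01.
Unshelve. all: by end_near.
Qed.

End Cone.

Section Alexander.
Context {R : realType}.
Implicit Types (t s u : R) (x y : 'rV[R]_3).

Definition dot (w x : 'rV[R]_3) : R := x ord0 axis1 * w ord0 axis1
  + x ord0 axis2 * w ord0 axis2 + x ord0 axis3 * w ord0 axis3.

Lemma dotD w x y : dot w (x + y) = dot w x + dot w y.
Proof. by rewrite /dot !mxE; ring. Qed.

Lemma dotZ w a x : dot w (a *: x) = a * dot w x.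
Proof. by rewrite /dot !mxE; ring. Qed.

Lemma dot_sub x y : dot (x - y) (x - y) = dot x x - 2 * dot y x + dot y y.
Proof. by rewrite /dot !mxE; ring. Qed.

Lemma dot_eq0 x : dot x x <= 0 -> x = 0.
Proof.
rewrite /dot -!expr2 => x0; apply/rowP.
have := sqr_ge0 (x ord0 axis1); have := sqr_ge0 (x ord0 axis2); have := sqr_ge0 (x ord0 axis3).
by move=> ? ? ?; apply: axis_ind; rewrite mxE; apply/eqP; rewrite -sqrf_eq0; apply/eqP; lra.
Qed.

Lemma dotB w x y : dot w (x - y) = dot w x - dot w y.
Proof. by rewrite dotD -scaleN1r dotZ mulN1r. Qed.

Variables (g : R -> 'rV[R]_3) (c d e w : 'rV[R]_3).
Hypotheses (gc : continuous g) (g01 : g 0 = g 1).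
Hypothesis gI : {in `[(0 : R), 1[ &, injective g}.
Hypothesis g_mid : forall t, 4^-1 <= t <= 3 / 4 -> g t = quad c d e t.
Hypothesis g_low : forall t, 0 <= t < 4^-1 \/ 3 / 4 < t <= 1 -> dot w (g t - c) < 0.
Hypotheses (wd : dot w d = 0) (we : 0 < dot w e) (de : indep2 d e).

Let Q : R -> 'rV[R]_3 := quad c d e.
Let D t : 'rV[R]_3 := g t - Q t.
(** The part to be shrunk straddles the base point, so the deviation [D] from the quadrilateral is
    compressed near time 0 and near time 1 separately; the clamps freeze the arguments at 1/4 and
    3/4, where [D] vanishes. Near the base point [Q] runs along a line through [c], which a
    homothety of centre [c] preserves. The result there is thus [g] itself scaled by [s] about
    [c]. *)
Let cone t s : 'rV[R]_3 := Q t + s *: D (clamp (4 * (t / s)) / 4) + s *: D (1 - clamp (4 * ((1 - t) / s)) / 4).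

Let D_mid t : 4^-1 <= t <= 3 / 4 -> D t = 0.
Proof. by move=> tm; rewrite /D g_mid ?subrr. Qed.

Let Q_low t : 0 <= t <= 4^-1 -> Q t = c + (4 * t) *: d.
Proof.
move=> t4; rewrite /Q /quad; have [-> ->] : quadX t = 4 * t /\ quadY t = 0.
  by have := @quadP _ t ltac:(lra); case=> [] [? ? ?]; lra.
by rewrite scale0r addr0.
Qed.

Let Q_high t : 3 / 4 <= t <= 1 -> Q t = c + (4 * t - 4) *: d.
Proof.
move=> t4; rewrite /Q /quad; have [-> ->] : quadX t = 4 * t - 4 /\ quadY t = 0.
  by have := @quadP _ t ltac:(lra); case=> [] [? ? ?]; lra.
by rewrite scale0r addr0.
Qed.

Let cone0 t : cone t 0 = Q t.
Proof. by rewrite /cone !scale0r !addr0. Qed.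

Let vanish s u : 0 < s -> s / 4 <= u -> clamp (4 * (u / s)) / 4 = 4^-1.
Proof.
move=> s0 su; rewrite clamp1 ?mul1r //.
by rewrite mulrA ler_pdivlMr // mul1r; lra.
Qed.

Let shrink s u : 0 < s -> 0 <= u <= s / 4 -> clamp (4 * (u / s)) / 4 = u / s.
Proof.
move=> s0 /andP[u0 us]; rewrite clamp_id; first by field; rewrite gt_eqF.
rewrite !mulr_ge0 ?invr_ge0 ?(ltW s0) //= mulrA ler_pdivrMr // mul1r; lra.
Qed.

Let cone_low t s : 0 < s <= 1 -> 0 <= t <= s / 4 -> cone t s = c + s *: (g (t / s) - c).
Proof.
move=> /andP[s0 s1] /andP[t0 ts]; rewrite /cone shrink ?t0 // vanish //; last by lra.
have ts4 : 0 <= t / s <= 4^-1.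
  by rewrite divr_ge0 ?(ltW s0) //= ler_pdivrMr //; lra.
have -> : D (1 - 4^-1) = 0 by apply: D_mid; lra.
rewrite scaler0 addr0 /D (@Q_low t) ?(@Q_low (t / s)) //; last by lra.
by apply/rowP => i; rewrite !mxE; field; rewrite gt_eqF.
Qed.

Let cone_mid t s : 0 < s <= 1 -> s / 4 <= t <= 1 - s / 4 -> cone t s = Q t.
Proof.
move=> /andP[s0 s1] /andP[t0 ts]; rewrite /cone !vanish //; last by lra.
have -> : D 4^-1 = 0 by apply: D_mid; lra.
have -> : D (1 - 4^-1) = 0 by apply: D_mid; lra.
by rewrite scaler0 !addr0.
Qed.

Let cone_high t s : 0 < s <= 1 -> 1 - s / 4 <= t <= 1 ->
  cone t s = c + s *: (g (1 - (1 - t) / s) - c).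
Proof.
move=> /andP[s0 s1] /andP[ts t1]; rewrite /cone vanish //; last by lra.
rewrite shrink //; last by lra.
have ts4 : 0 <= (1 - t) / s <= 4^-1.
  by rewrite divr_ge0 ?(ltW s0) ?subr_ge0 //= ler_pdivrMr //; lra.
have -> : D 4^-1 = 0 by apply: D_mid; lra.
rewrite scaler0 addr0 /D (@Q_high t) ?(@Q_high (1 - _)) //; try (by apply/andP; lra).
by apply/rowP => i; rewrite !mxE; field; rewrite gt_eqF.
Qed.

Let cone_inj s : 0 < s <= 1 -> {in `[(0 : R), 1[ &, injective (cone ^~ s)}.
Proof.
move=> s01; have /andP[s0 s1] := s01.
have sI x y : c + s *: (x - c) = c + s *: (y - c) -> x = y.
  by move/addrI/(scalerI (lt0r_neq0 s0))/addIr.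
have low t : 0 <= t < s / 4 -> 0 <= t / s < 4^-1.
  by move=> /andP[t0 ts]; rewrite divr_ge0 ?(ltW s0) //= ltr_pdivrMr //; lra.
have high t : 1 - s / 4 < t < 1 -> 3 / 4 < 1 - (1 - t) / s < 1.
  move=> /andP[ts t1]; rewrite ltrBrDl -ltrBrDr ltr_pdivrMr // gtrBl divr_gt0 ?subr_gt0 //.
  by rewrite andbT; lra.
(* The sign of the functional tells the wedge from the shrunk part: homotheties of centre [c] keep
   the latter strictly negative. *)
have sign t : 0 <= t < 1 -> (0 <= dot w (cone t s - c)) = (s / 4 <= t <= 1 - s / 4).
  move=> t01; have [t4|t4] := ltP t (s / 4).
    rewrite cone_low //; last by lra.
    rewrite addrAC subrr add0r dotZ pmulr_rge0 // leNgt g_low //; left; apply: low; lra.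
  have [t4'|t4'] := leP t (1 - s / 4); last first.
    rewrite cone_high //; last by lra.
    rewrite addrAC subrr add0r dotZ pmulr_rge0 // leNgt g_low //; right.
    by have := high t ltac:(lra); lra.
  rewrite cone_mid //; last by lra.
  have -> : Q t - c = quadX t *: d + quadY t *: e.
    by apply/rowP => i; rewrite !mxE; ring.
  rewrite dotD !dotZ wd mulr0 add0r /=.
  apply: mulr_ge0; last exact: ltW.
  by have := @quadP _ t ltac:(lra); case=> [] [? ? ?]; lra.
move=> t u; rewrite !in_itv /= => t01 u01 E.
have := sign t t01; rewrite E sign // => regions.
have [tm|tm] := boolP (s / 4 <= t <= 1 - s / 4).
  move: E; rewrite !cone_mid ?regions //.
  by apply: quad_inj; rewrite ?in_itv.
rewrite -regions in tm; have um := tm; rewrite regions in tm.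
have [t4|t4] := ltP t (s / 4); have [u4|u4] := ltP u (s / 4).
- move: E; rewrite !cone_low //; try lra; move=> /sI /gI.
  have := low t ltac:(lra); have := low u ltac:(lra) => ut tt.
  rewrite !in_itv /= => /(_ ltac:(lra) ltac:(lra)) /(mulIf _); apply.
  by rewrite invr_eq0 gt_eqF.
- move: E; rewrite cone_low ?cone_high //; try lra; move=> /sI /gI.
  have := low t ltac:(lra); have := high u ltac:(lra) => ut tt.
  by rewrite !in_itv /= => /(_ ltac:(lra) ltac:(lra)); lra.
- move: E; rewrite cone_high ?cone_low //; try lra; move=> /sI /gI.
  have := high t ltac:(lra); have := low u ltac:(lra) => ut tt.
  by rewrite !in_itv /= => /(_ ltac:(lra) ltac:(lra)); lra.
move: E; rewrite !cone_high //; try lra; move=> /sI /gI.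
have := high t ltac:(lra); have := high u ltac:(lra) => ut tt.
rewrite !in_itv /= => /(_ ltac:(lra) ltac:(lra)) /addrI/oppr_inj/(mulIf _).
by rewrite invr_eq0 gt_eqF // => /(_ isT) /addrI/oppr_inj.
Qed.

Let D_continuous : continuous D.
Proof. by apply: continuous_sub => //; apply: quad_continuous. Qed.

Let D_bounded : exists M, forall t, 0 <= t <= 1 -> `|D t| <= M.
Proof.
have [|t _ DM] := @EVT_max R (fun t => `|D t|) 0 1 ler01.
  apply: continuous_subspaceT => t.
  by apply: continuous_comp; [exact: D_continuous|exact: norm_continuous].
by exists (`|D t|) => u u01; apply: DM; rewrite in_itv.
Qed.

Lemma alexander_isotopy : knot_equiv g (quad c d e).
Proof.
(* The cone is the quadrilateral at [s = 0] and [g] at [s = 1], hence the symmetry. *)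
apply: knot_equiv_sym; apply: (isotopy_knot_equiv (H := fun x : R * R => cone x.1 x.2)).
have clc : continuous (fun u : R => clamp (4 * u) / 4).
  apply: continuous_mulr; last exact: continuous_cst.
  by apply: continuous_clamp; apply: continuous_mulr; [exact: continuous_cst|move=> x; exact: cvg_id].
have cl01 u : 0 <= clamp u / 4 <= 1.
  by have := clamp_itv u; rewrite in_itv /=; lra.
have [M DM] := D_bounded.
split=> [|t t01|t|s].
- apply: continuous_add; first apply: continuous_add.
  + exact: (continuous_comp2 (@continuous_fst _ _) (@quad_continuous _ _ _ _)).
  + apply: (cone_continuous (D := fun u => D (clamp (4 * u) / 4))).
      exact: (continuous_comp2 clc D_continuous).
    by exists M => u; apply: DM.
  (* The deviation near time 1 is of the same kind after the change of variable [1 - t]. *)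
  + have : continuous (fun x : R * R => x.2 *: (fun u => D (1 - clamp (4 * u) / 4)) (x.1 / x.2)).
      apply: (cone_continuous (D := fun u => D (1 - clamp (4 * u) / 4))).
        apply: (continuous_comp2 _ D_continuous); apply: continuous_subr => //.
        exact: continuous_cst.
      by exists M => u; apply: DM; have := cl01 (4 * u); lra.
    have : continuous (fun x : R * R => (1 - x.1, x.2)).
      apply: continuous_pair; last exact: continuous_snd.
      by apply: continuous_subr; [exact: continuous_cst|exact: continuous_fst].
    by move=> c1 c2; apply: (continuous_comp2 c1 c2).
- by rewrite /= cone0.
- rewrite in_itv /= => t01; have s01 : 0 < (1 : R) <= 1 by rewrite ltr01 lexx.
  have [t4|t4] := leP t 4^-1.
    by rewrite cone_low // ?divr1 ?scale1r ?(addrC c) ?subrK //; lra.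
  have [t4'|t4'] := leP t (3 / 4); first by rewrite cone_mid // ?g_mid //; lra.
  rewrite cone_high //; last by lra.
  by rewrite divr1 scale1r (addrC c) subrK; congr g; ring.
rewrite in_itv /= => /andP[]; rewrite le_eqVlt => /orP[/eqP <- _|s0 s1].
  rewrite !cone0 /Q quad0 quad1; split=> // t u t01 u01; rewrite !cone0.
  exact: quad_inj.
have s01 : 0 < s <= 1 by rewrite s0.
split; last exact: cone_inj.
rewrite cone_low //; last by lra.
by rewrite cone_high //; [rewrite mul0r subrr mul0r subr0 g01|lra].
Qed.

End Alexander.

(** * Reparametrization of loops *)

Section Reparametrization.
Context {R : realType}.
Implicit Types (t s u : R).

Lemma clamp_mono t u : t <= u -> clamp t <= clamp u.
Proof.
move=> tu; rewrite /clamp ge_max le_max lexx /= le_max; apply/orP.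
by have [u1|u1] := leP u 1; right; [rewrite ge_min tu|rewrite ge_min lexx orbT].
Qed.

(** Serves to bound the slope of [quarters] from below. *)
Lemma ramp_sum t : 0 <= t <= 1 -> ramp 0 t + ramp 1 t + ramp 2 t + ramp 3 t = 4 * t.
Proof.
move=> t01; rewrite /ramp; have [t1|t1] := leP t 4^-1.
  have -> : clamp (4 * t - 0) = 4 * t - 0 by apply: clamp_id; lra.
  have -> : clamp (4 * t - 1) = 0 by apply: clamp0; lra.
  have -> : clamp (4 * t - 2) = 0 by apply: clamp0; lra.
  have -> : clamp (4 * t - 3) = 0 by apply: clamp0; lra.
  by ring.
have -> : clamp (4 * t - 0) = 1 by apply: clamp1; lra.
have [t2|t2] := leP t 2^-1.
  have -> : clamp (4 * t - 1) = 4 * t - 1 by apply: clamp_id; lra.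
  have -> : clamp (4 * t - 2) = 0 by apply: clamp0; lra.
  have -> : clamp (4 * t - 3) = 0 by apply: clamp0; lra.
  by ring.
have -> : clamp (4 * t - 1) = 1 by apply: clamp1; lra.
have [t3|t3] := leP t (3 / 4).
  have -> : clamp (4 * t - 2) = 4 * t - 2 by apply: clamp_id; lra.
  have -> : clamp (4 * t - 3) = 0 by apply: clamp0; lra.
  by ring.
have -> : clamp (4 * t - 2) = 1 by apply: clamp1; lra.
have -> : clamp (4 * t - 3) = 4 * t - 3 by apply: clamp_id; lra.
by ring.
Qed.

(** Convex combinations of the identity and [h] are again increasing and fix both ends. *)
Lemma knot_equiv_reparam (g : R -> 'rV[R]_3) (h : R -> R) :
  continuous g -> g 0 = g 1 -> {in `[(0 : R), 1[ &, injective g} ->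
  continuous h -> h 0 = 0 -> h 1 = 1 ->
  (forall t u, 0 <= t -> t < u -> u <= 1 -> h t < h u) ->
  knot_equiv g (g \o h).
Proof.
move=> gc g01 gI hc h0 h1 hI.
apply: (isotopy_knot_equiv (H := fun x : R * R => g ((1 - x.2) * x.1 + x.2 * h x.1))).
split=> [|t t01|t t01|s].
- apply: (continuous_comp2 _ gc); apply: continuous_addr; apply: continuous_mulr.
  + by apply: continuous_subr; [exact: continuous_cst|exact: continuous_snd].
  + exact: continuous_fst.
  + exact: continuous_snd.
  + exact: (continuous_comp2 (@continuous_fst _ _) hc).
- by rewrite /= subr0 mul1r mul0r addr0.
- by rewrite /= subrr mul0r mul1r add0r.
rewrite in_itv /= => /andP[s0 s1]; rewrite h0 h1 !mulr0 !mulr1 addr0 subrK; split=> //.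
pose k t := (1 - s) * t + s * h t.
have kI t u : 0 <= t -> t < u -> u <= 1 -> k t < k u.
  move=> t0 tu u1; have := hI t u t0 tu u1; rewrite /k => htu.
  move: s0; rewrite le_eqVlt => /orP[/eqP <-|s0].
    by rewrite subr0 !mul1r !mul0r !addr0.
  by apply: ler_ltD; [rewrite ler_wpM2l ?subr_ge0 // ltW|rewrite ltr_pM2l].
have k0 : k 0 = 0 by rewrite /k h0 !mulr0 addr0.
have k1 : k 1 = 1 by rewrite /k h1 !mulr1 subrK.
have k01 t : 0 <= t < 1 -> 0 <= k t < 1.
  move=> /andP[t0 t1]; rewrite -[X in _ < X]k1 kI // andbT.
  by move: t0; rewrite le_eqVlt => /orP[/eqP <-|t0]; rewrite ?k0 // -k0 ltW // kI // ltW.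
move=> t u; rewrite !in_itv /= => t01 u01 /gI; rewrite !in_itv /= => /(_ (k01 _ t01) (k01 _ u01)).
move: t01 u01 => /andP[t0 t1] /andP[u0 u1] E.
have [tu|ut|//] := ltgtP t u.
  by have := kI t u t0 tu (ltW u1); rewrite /k E ltxx.
by have := kI u t u0 ut (ltW t1); rewrite /k E ltxx.
Qed.

Lemma knot_equiv_eql (g g' k : R -> 'rV[R]_3) :
  (forall t, 0 <= t <= 1 -> g t = g' t) -> knot_equiv g' k -> knot_equiv g k.
Proof.
move=> gg' [h [hc h0 h1 hI]]; exists h; split=> // t t01.
by rewrite h0 // gg' //; move: t01; rewrite in_itv.
Qed.

Variables t1 t0 t2 : R.
Hypotheses (t1_gt0 : 0 < t1) (t10 : t1 < t0) (t02 : t0 < t2) (t2_lt1 : t2 < 1).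

(* Maps 0, 1/4, 1/2, 3/4, 1 to 0, t1, t0, t2, 1 and is affine in between. *)
Definition quarters t :=
  t1 * ramp 0 t + (t0 - t1) * ramp 1 t + (t2 - t0) * ramp 2 t + (1 - t2) * ramp 3 t.

Lemma quarters_continuous : continuous quarters.
Proof.
by apply: continuous_addr; [apply: continuous_addr; [apply: continuous_addr|]|];
  apply: continuous_mulr; [exact: continuous_cst|exact: ramp_continuous
    |exact: continuous_cst|exact: ramp_continuous|exact: continuous_cst
    |exact: ramp_continuous|exact: continuous_cst|exact: ramp_continuous].
Qed.

Lemma quarters_increasing t u : 0 <= t -> t < u -> u <= 1 -> quarters t < quarters u.
Proof.
move=> t_ge0 tu u1; have sumt := @ramp_sum t ltac:(lra); have sumu := @ramp_sum u ltac:(lra).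
have mono a : 0 <= ramp a u - ramp a t by rewrite subr_ge0; apply: clamp_mono; lra.
(* The least of the four weights: all increments of ramps are nonnegative and add up to
   [4 * (u - t)], so [quarters] grows by at least [m] times this. *)
pose m := Num.min (Num.min t1 (t0 - t1)) (Num.min (t2 - t0) (1 - t2)).
have m0 : 0 < m by rewrite !lt_min t1_gt0 !subr_gt0 t10 t02.
have [mt1 m01 m20 m2] : [/\ m <= t1, m <= t0 - t1, m <= t2 - t0 & m <= 1 - t2].
  by split; rewrite !ge_min lexx ?orbT.
rewrite -subr_gt0; apply: lt_le_trans (_ : m * (4 * u - 4 * t) <= _).
  by rewrite mulr_gt0 //; lra.
rewrite -sumt -sumu.
have := ler_wpM2r (mono 0) mt1; have := ler_wpM2r (mono 1) m01.
have := ler_wpM2r (mono 2) m20; have := ler_wpM2r (mono 3) m2.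
rewrite /quarters; lra.
Qed.

Lemma quarters_low t : 0 <= t <= 4^-1 -> quarters t = 4 * t * t1.
Proof.
move=> t01; rewrite /quarters /ramp.
have -> : clamp (4 * t - 0) = 4 * t - 0 by apply: clamp_id; lra.
have -> : clamp (4 * t - 1) = 0 by apply: clamp0; lra.
have -> : clamp (4 * t - 2) = 0 by apply: clamp0; lra.
have -> : clamp (4 * t - 3) = 0 by apply: clamp0; lra.
by ring.
Qed.

Lemma quarters_mid_low t : 4^-1 <= t <= 2^-1 -> quarters t = t0 - (2 - 4 * t) * (t0 - t1).
Proof.
move=> t01; rewrite /quarters /ramp.
have -> : clamp (4 * t - 0) = 1 by apply: clamp1; lra.
have -> : clamp (4 * t - 1) = 4 * t - 1 by apply: clamp_id; lra.
have -> : clamp (4 * t - 2) = 0 by apply: clamp0; lra.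
have -> : clamp (4 * t - 3) = 0 by apply: clamp0; lra.
by ring.
Qed.

Lemma quarters_mid_high t : 2^-1 <= t <= 3 / 4 -> quarters t = t0 + (4 * t - 2) * (t2 - t0).
Proof.
move=> t01; rewrite /quarters /ramp.
have -> : clamp (4 * t - 0) = 1 by apply: clamp1; lra.
have -> : clamp (4 * t - 1) = 1 by apply: clamp1; lra.
have -> : clamp (4 * t - 2) = 4 * t - 2 by apply: clamp_id; lra.
have -> : clamp (4 * t - 3) = 0 by apply: clamp0; lra.
by ring.
Qed.

Lemma quarters_high t : 3 / 4 <= t <= 1 -> quarters t = t2 + (4 * t - 3) * (1 - t2).
Proof.
move=> t01; rewrite /quarters /ramp.
have -> : clamp (4 * t - 0) = 1 by apply: clamp1; lra.
have -> : clamp (4 * t - 1) = 1 by apply: clamp1; lra.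
have -> : clamp (4 * t - 2) = 1 by apply: clamp1; lra.
have -> : clamp (4 * t - 3) = 4 * t - 3 by apply: clamp_id; lra.
by ring.
Qed.

End Reparametrization.

(** * Unknotting of locally affine loops *)

Section Unknot.
Context {R : realType}.
Variable g : R -> 'rV[R]_3.
Hypotheses (gc : continuous g) (g01 : g 0 = g 1).
Hypothesis gI : {in `[(0 : R), 1[ &, injective g}.
Implicit Types t s : R.

Lemma dot_continuous (T : topologicalType) (f h : T -> 'rV[R]_3) :
  continuous f -> continuous h -> continuous (fun x => dot (f x) (h x)).
Proof.
move=> fc hc; have coord (k : T -> 'rV[R]_3) i : continuous k -> continuous (fun x => k x ord0 i).
  move=> kc; apply: (continuous_comp2 (g := fun x : 'rV[R]_3 => x ord0 i) kc).
  exact: coord_continuous.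
by do !apply: continuous_addr; apply: continuous_mulr; apply: coord.
Qed.

(* The point of the loop farthest from g 0 is the only maximum of a linear functional. *)
Lemma strict_linear_max : exists w t0, 0 < t0 < 1 /\
  forall t, 0 <= t <= 1 -> t != t0 -> dot w (g t) < dot w (g t0).
Proof.
pose q t : 'rV[R]_3 := g t - g 0.
have qc : continuous q by apply: continuous_sub => //; apply: continuous_cst.
have [|t0 + t0max] := @EVT_max R (fun t => dot (q t) (q t)) 0 1 ler01.
  by apply: continuous_subspaceT; apply: dot_continuous.
rewrite in_itv /= => /andP[t0_ge0 t0_le1].
have half : 0 < dot (q 2^-1) (q 2^-1).
  rewrite ltNge; apply/negP => /dot_eq0/eqP; rewrite subr_eq0 => /eqP/gI.
  by rewrite !in_itv /= => /(_ ltac:(lra) ltac:(lra)); lra.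
have qt0 : 0 < dot (q t0) (q t0).
  by apply: lt_le_trans half (t0max _ _); rewrite in_itv /=; lra.
have t0_neq0 : t0 != 0 by apply: contraTneq qt0 => ->; rewrite /q subrr /dot !mxE !mulr0 !addr0 ltxx.
have t0_neq1 : t0 != 1.
  by apply: contraTneq qt0 => ->; rewrite /q -g01 subrr /dot !mxE !mulr0 !addr0 ltxx.
have t001 : 0 < t0 < 1 by rewrite !lt_neqAle eq_sym t0_neq0 t0_ge0 t0_neq1.
exists (q t0), t0; split=> // t t01 tt0.
suff : dot (q t0) (q t) < dot (q t0) (q t0) by rewrite !dotB ltrD2r.
rewrite ltNge; apply/negP => le_qt.
(* Expand the square: [q t] is no longer than [q t0], and its product with [q t0] is assumed to be
   at least the square of [q t0]. *)
have : dot (q t - q t0) (q t - q t0) <= 0.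
  have := t0max t; rewrite in_itv /= => /(_ t01).
  by rewrite dot_sub; lra.
move=> /dot_eq0/eqP; rewrite subr_eq0 => /eqP/addIr gtt.
have [t1|t1] := ltP t 1.
  by move/gI: gtt; rewrite !in_itv /= => /(_ ltac:(lra) ltac:(lra)) /eqP; rewrite (negPf tt0).
have t_1 : t = 1 by lra.
move: gtt; rewrite t_1 -g01 => /gI; rewrite !in_itv /= => /(_ ltac:(lra) ltac:(lra)).
by move/esym/eqP; rewrite (negPf t0_neq0).
Qed.

(** The level [lambda] cuts the loop at two points; between them it runs along two sides of a
    triangle with apex [g t0]. After [quarters] this is the middle half of a quadrilateral, and the
    rest lies below the level, as the Alexander trick requires. *)
Lemma wedge_std w t0 s1 s2 lambda (v1 v2 : 'rV[R]_3) : 0 < s1 -> 0 < s2 ->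
  0 < t0 - s1 -> t0 + s2 < 1 ->
  (forall s, 0 <= s <= s1 -> g (t0 - s) = g t0 + s *: v1) ->
  (forall s, 0 <= s <= s2 -> g (t0 + s) = g t0 + s *: v2) ->
  dot w (g (t0 - s1)) = lambda -> dot w (g (t0 + s2)) = lambda -> lambda < dot w (g t0) ->
  (forall t, 0 <= t < t0 - s1 \/ t0 + s2 < t <= 1 -> dot w (g t) < lambda) ->
  knot_equiv g std_quad.
Proof.
move=> s1_gt0 s2_gt0; set t1 := t0 - s1; set t2 := t0 + s2 => t1_gt0 t2_lt1 gL gR pt1 pt2 lam low.
have t10 : t1 < t0 by rewrite /t1; lra.
have t02 : t0 < t2 by rewrite /t2; lra.
have gt1 : g t1 = g t0 + s1 *: v1 by rewrite gL // (ltW s1_gt0) lexx.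
have gt2 : g t2 = g t0 + s2 *: v2 by rewrite gR // (ltW s2_gt0) lexx.
have t01E : t0 - t1 = s1 by rewrite /t1; ring.
have t02E : t2 - t0 = s2 by rewrite /t2; ring.
have t12 : t1 < t2 by exact: lt_trans t02.
clearbody t1 t2.
(* Chosen so that [c + d], [c + e], [c - d] are the cut points and the apex, the vertices of the
   quadrilateral at times 1/4, 1/2 and 3/4. *)
pose c := 2^-1 *: (g t1 + g t2); pose d := 2^-1 *: (g t1 - g t2); pose e := g t0 - c.
have wc : dot w c = lambda by rewrite dotZ dotD pt1 pt2; field.
have wd : dot w d = 0 by rewrite dotZ dotB pt1 pt2; ring.
have we : 0 < dot w e by rewrite dotB wc subr_gt0.
have de : indep2 d e.
  move=> x y E; have /eqP : dot w (x *: d + y *: e) = 0 by rewrite E /dot !mxE !mul0r !addr0.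
  rewrite dotD (dotZ w x) (dotZ w y) wd mulr0 add0r mulf_eq0 (gt_eqF we) orbF => /eqP y0; split=> //.
  move: E; rewrite y0 scale0r addr0 => /eqP; rewrite scaler_eq0 => /orP[/eqP //|].
  rewrite scaler_eq0 invr_eq0 pnatr_eq0 /= subr_eq0 => /eqP/gI.
  by rewrite !in_itv /= => /(_ ltac:(lra) ltac:(lra)); lra.
pose h := quarters t1 t0 t2.
have hI := quarters_increasing t1_gt0 t10 t02 t2_lt1.
have h0 : h 0 = 0 by rewrite /h quarters_low; lra.
have h1 : h 1 = 1 by rewrite /h quarters_high; lra.
have hc : continuous h by apply: quarters_continuous.
have g_gh : knot_equiv g (g \o h) by apply: knot_equiv_reparam.
apply: knot_equiv_trans g_gh _.
apply: knot_equiv_trans _ (quad_std c de).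
have h01 t : 0 <= t < 1 -> 0 <= h t < 1.
  move=> /andP[t_ge0 t_lt1]; rewrite -[X in _ < X]h1 hI // andbT.
  by move: t_ge0; rewrite le_eqVlt => /orP[/eqP <-|t_gt0]; rewrite ?h0 // -h0 ltW // hI // ltW.
apply: (alexander_isotopy _ _ _ _ _ wd we de).
- exact: (continuous_comp2 hc gc).
- by rewrite /= h0 h1.
- move=> t u; rewrite !in_itv /= => t01 u01 /gI.
  rewrite !in_itv /= => /(_ (h01 _ t01) (h01 _ u01)) E.
  move: t01 u01 => /andP[t_ge0 t_lt1] /andP[u_ge0 u_lt1].
  have [tu|ut|//] := ltgtP t u.
    by have := hI t u t_ge0 tu (ltW u_lt1); rewrite -/h E ltxx.
  by have := hI u t u_ge0 ut (ltW t_lt1); rewrite -/h E ltxx.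
- move=> t t4; rewrite /= /quad.
  have [t2'|/ltW t2'] := leP t 2^-1.
    have [-> ->] := @quad_mid_low _ t ltac:(by rewrite t2'; case/andP: t4 => ->).
    rewrite /h quarters_mid_low ?t01E ?gL; last 2 first.
    + by rewrite mulr_ge0 ?(ltW s1_gt0) ?ger_pMl //; clear -t4 t2'; lra.
    + by clear -t4 t2'; lra.
    by rewrite /e /c /d gt1 gt2; apply/rowP => i; rewrite !mxE; field.
  have [-> ->] := @quad_mid_high _ t ltac:(by rewrite t2'; case/andP: t4 => _ ->).
  rewrite /h quarters_mid_high ?t02E ?gR; last 2 first.
  + by rewrite mulr_ge0 ?(ltW s2_gt0) ?ger_pMl //; clear -t4 t2'; lra.
  + by clear -t4 t2'; lra.
  by rewrite /e /c /d gt1 gt2; apply/rowP => i; rewrite !mxE; field.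
move=> t; rewrite dotB wc subr_lt0 => -[/andP[ta tb]|/andP[ta tb]].
  apply: low; left; rewrite /= /h quarters_low; last by clear -ta tb; lra.
  by rewrite gtr_pMl // mulr_ge0 ?(ltW t1_gt0) /=; clear -ta tb; lra.
apply: low; right; rewrite /= /h quarters_high; last by clear -ta tb; lra.
have t3 : 0 < 4 * t - 3 by lra.
have : (4 * t - 3) * (1 - t2) <= 1 - t2 by rewrite ger_pMl ?subr_gt0; lra.
have := mulr_gt0 t3 (ltac:(lra) : 0 < 1 - t2).
by lra.
Qed.

Hypothesis g_ray : forall t, 0 < t < 1 -> ray_affine g t 1 /\ ray_affine g t (-1).

(** At a strict maximum the functional has negative slope along the germ, so a slightly lower level
    cuts it exactly once. *)
Lemma linear_max_slope w t0 e (x : R) : 0 < x ->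
  (forall s, 0 < s <= x -> dot w (g (t0 + s * e)) < dot w (g t0)) ->
  ray_affine g t0 e -> exists d v, [/\ 0 < d, d <= x, dot w v < 0
    & forall s, 0 <= s <= d -> g (t0 + s * e) = g t0 + s *: v].
Proof.
move=> x0 wlt [d d0 [v gv]]; exists (Num.min d x), v.
have m0 : 0 < Num.min d x by rewrite lt_min d0.
split=> //; first by rewrite ge_min lexx orbT.
  have := wlt (Num.min d x); rewrite m0 ge_min lexx orbT => /(_ isT).
  by rewrite gv ?(ltW m0) ?ge_min ?lexx // dotD dotZ gtrDl pmulr_rlt0.
by move=> s; rewrite le_min => /and3P[s0 sd _]; apply: gv; rewrite s0.
Qed.

Lemma locally_affine_std : knot_equiv g std_quad.
Proof.
have [w [t0 [t001 wmax]]] := strict_linear_max.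
have /andP[t0_gt0 t0_lt1] := t001.
have [rayR rayL] := g_ray t001.
pose phi t := dot w (g t).
have phic : continuous phi by apply: dot_continuous => //; apply: continuous_cst.
have [||d1 [v1 [d1_gt0 d1t0 wv1 gv1]]] := @linear_max_slope w t0 (-1) t0 _ _ rayL.
- by [].
- by move=> s st; rewrite mulrN1; apply: wmax; [lra|apply/eqP; lra].
have [||d2 [v2 [d2_gt0 d2t0 wv2 gv2]]] := @linear_max_slope w t0 1 (1 - t0) _ _ rayR.
- by rewrite subr_gt0.
- by move=> s st; rewrite mulr1; apply: wmax; [lra|apply/eqP; lra].
(* By compactness the functional stays away from its strict maximum outside the two germs. *)
have bound a b : 0 <= a -> a <= b -> b <= 1 -> ~~ (a <= t0 <= b) ->
    exists2 M, M < phi t0 & forall t, a <= t <= b -> phi t <= M.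
  move=> a0 ab b1 t0ab; have [|m + mM] := @EVT_max R phi a b ab.
    exact: continuous_subspaceT.
  rewrite in_itv /= => mab; exists (phi m).
    by apply: wmax; [lra|apply: contraNneq t0ab => <-].
  by move=> t tab; apply: mM; rewrite in_itv.
have [||||M1 M1lt phiM1] := bound 0 (t0 - d1); try lra.
have [||||M2 M2lt phiM2] := bound (t0 + d2) 1; try lra.
pose a1 := - dot w v1; pose a2 := - dot w v2.
have a1_gt0 : 0 < a1 by rewrite oppr_gt0.
have a2_gt0 : 0 < a2 by rewrite oppr_gt0.
(* The drop of the level below the maximum. The halves keep the level strictly above [M1] and [M2],
   and the cut times strictly inside the germs. *)
pose eta := Num.min (Num.min ((phi t0 - M1) / 2) ((phi t0 - M2) / 2))
  (Num.min (d1 * a1 / 2) (d2 * a2 / 2)).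
have eta_gt0 : 0 < eta by rewrite !lt_min !divr_gt0 ?mulr_gt0 ?subr_gt0.
have [eM1 eM2 ed1 ed2] : [/\ eta <= (phi t0 - M1) / 2, eta <= (phi t0 - M2) / 2,
    eta <= d1 * a1 / 2 & eta <= d2 * a2 / 2].
  by split; rewrite !ge_min lexx ?orbT.
pose s1 := eta / a1; pose s2 := eta / a2.
have s1_gt0 : 0 < s1 by rewrite divr_gt0.
have s2_gt0 : 0 < s2 by rewrite divr_gt0.
have s1d1 : s1 < d1.
  by rewrite ltr_pdivrMr //; apply: le_lt_trans ed1 _; have := mulr_gt0 d1_gt0 a1_gt0; lra.
have s2d2 : s2 < d2.
  by rewrite ltr_pdivrMr //; apply: le_lt_trans ed2 _; have := mulr_gt0 d2_gt0 a2_gt0; lra.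
pose t1 := t0 - s1; pose t2 := t0 + s2.
have t1_gt0 : 0 < t1 by rewrite /t1; lra.
have t2_lt1 : t2 < 1 by rewrite /t2; lra.
have gL s : 0 <= s <= d1 -> g (t0 - s) = g t0 + s *: v1 by move=> sd; rewrite -gv1 // mulrN1.
have gR s : 0 <= s <= d2 -> g (t0 + s) = g t0 + s *: v2 by move=> sd; rewrite -gv2 // mulr1.
have phiL s : 0 <= s <= d1 -> phi (t0 - s) = phi t0 - s * a1.
  by move=> sd; rewrite /phi gL // dotD dotZ /a1 mulrN opprK.
have phiR s : 0 <= s <= d2 -> phi (t0 + s) = phi t0 - s * a2.
  by move=> sd; rewrite /phi gR // dotD dotZ /a2 mulrN opprK.
have lowL t : 0 <= t < t1 -> phi t < phi t0 - eta.
  move=> /andP[t_ge0 tt1]; have [td|td] := leP t (t0 - d1).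
    by have := phiM1 t ltac:(lra); lra.
  have -> : t = t0 - (t0 - t) by ring.
  rewrite phiL; last by move: tt1; rewrite /t1; lra.
  rewrite ltrD2l ltrN2 -ltr_pdivrMr // -/s1; move: tt1; rewrite /t1; lra.
have lowR t : t2 < t <= 1 -> phi t < phi t0 - eta.
  move=> /andP[tt2 t_le1]; have [td|td] := leP (t0 + d2) t.
    by have := phiM2 t ltac:(lra); lra.
  have -> : t = t0 + (t - t0) by ring.
  rewrite phiR; last by move: tt2; rewrite /t2; lra.
  rewrite ltrD2l ltrN2 -ltr_pdivrMr // -/s2; move: tt2; rewrite /t2; lra.
apply: (@wedge_std w t0 s1 s2 (phi t0 - eta) v1 v2) => //.
- by move=> s /andP[s_ge0 ss]; apply: gL; rewrite s_ge0 (le_trans ss) // ltW.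
- by move=> s /andP[s_ge0 ss]; apply: gR; rewrite s_ge0 (le_trans ss) // ltW.
- by rewrite -/(phi _) phiL ?(ltW s1_gt0) ?(ltW s1d1) // divfK // gt_eqF.
- by rewrite -/(phi _) phiR ?(ltW s2_gt0) ?(ltW s2d2) // divfK // gt_eqF.
- by rewrite gtrBl.
by move=> t [/lowL|/lowR].
Qed.

End Unknot.

Section LocallyAffineLoops.
Context {R : realType}.
Implicit Type g : R -> 'rV[R]_3.

Lemma locally_affine_unknot g : locally_affine g -> g 0 = g 1 ->
  {in `[(0 : R), 1[ &, injective g} -> simple_loop g /\ knot_equiv g std_quad.
Proof.
move=> gla g01 gI; have gc := locally_affine_continuous gla; have [gr gl] := gla.
have cl t : 0 <= t <= 1 -> (g \o clamp) t = g t by move=> t01; rewrite /= clamp_id.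
split.
  split; last exact: gI.
  split; last exact: g01.
  by apply: (within_continuous_eq gc) => t /=; rewrite in_itv /= => /cl.
apply: (@knot_equiv_eql _ _ (g \o clamp)) => [t /cl //|].
apply: locally_affine_std => //.
- by rewrite !cl ?lexx ?ler01.
- move=> t u; rewrite !in_itv /= => /andP[t0 t1] /andP[u0 u1].
  by rewrite !clamp_id ?t0 ?u0 ?ltW //; apply: gI; rewrite in_itv /= ?t0 ?u0.
move=> t /andP[t0 t1]; split.
  apply: (ray_affine_eq (d := 1 - t)) (gr t _) => [|s|]; rewrite ?subr_gt0 ?(ltW t0) // => st.
  by rewrite cl //; lra.
apply: (ray_affine_eq (d := t)) (gl t _) => [|s|]; rewrite ?t0 ?(ltW t1) // => st.
by rewrite cl //; lra.
Qed.

Lemma close_with_unknot N (p : seq 'rV[R]_3) g : (1 < size p)%N ->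
  p`_0 = g 0 -> last 0 p = g 1 -> piecewise_affine g ->
  {in `[(0 : R), 1] &, injective g} ->
  (forall t : R, t \in `[(0 : R), 1] -> cube_boundary N (g t)) ->
  (forall t u, 0 <= t <= (size p).-1%:R -> 0 <= u <= (size p).-1%:R ->
     polygon p t = polygon p u -> t = u) ->
  (forall t a, 0 < t < (size p).-1%:R -> 0 < polygon p t ord0 a < N%:R) ->
  simple_loop (close_with p g) /\ knot_equiv (close_with p g) std_quad.
Proof.
move=> p1 p0 plast gpa gI gb pI pin.
pose n : R := (size p).-1%:R.
have n0 : 0 < n by rewrite ltr0n; case: (size p) p1 => [|[]].
have polyn : polygon p n = g 1 by rewrite polygon_nat nth_last.
have poly0 : polygon p 0 = g 0 by rewrite -[0]/(0%:R) polygon_nat.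
(* Inside its range the polygon is in the open cube, away from the boundary curve; its two ends are
   [g 0] and [g 1], which [g] takes at no time in between. *)
have cross t u : 0 <= t <= n -> 0 < u < 1 -> polygon p t <> g u.
  move=> /andP[t0 tn] /andP[u0 u1] E.
  have uI : u \in `[(0 : R), 1] by rewrite in_itv /= !ltW.
  move: t0; rewrite le_eqVlt => /orP[/eqP t0|t0].
    move: E; rewrite -t0 poly0 => /gI; rewrite in_itv /= lexx ler01 => /(_ isT uI) E.
    by rewrite E ltxx in u0.
  move: tn; rewrite le_eqVlt => /orP[/eqP tn|tn].
    move: E; rewrite tn polyn => /gI; rewrite in_itv /= lexx ler01 => /(_ isT uI) E.
    by rewrite E ltxx in u1.
  have [a] := cube_boundary_out (gb u uI).
  by rewrite -E pin // t0.
apply: locally_affine_unknot.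
- exact: close_with_locally_affine.
- rewrite /close_with; have -> : (0 : R) <= 2^-1 by rewrite invr_ge0.
  have -> : ((1 : R) <= 2^-1) = false by apply/negbTE; rewrite -ltNge; lra.
  by rewrite mulr0 mul0r poly0; congr g; lra.
have lowt t : 0 <= t -> t <= 2^-1 -> 0 <= 2 * t * n <= n.
  move=> t0 t2; rewrite !mulr_ge0 ?(ltW n0) //= ger_pMl //; lra.
move=> t u; rewrite !in_itv /= => /andP[t0 t1] /andP[u0 u1]; rewrite /close_with -/n.
have [t2|t2] := leP t 2^-1; have [u2|u2] := leP u 2^-1.
- move=> /pI; rewrite -/n => /(_ (lowt _ t0 t2) (lowt _ u0 u2)) /mulIf.
  by rewrite gt_eqF // => /(_ isT) /mulfI; apply; rewrite pnatr_eq0.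
- by move=> E; exfalso; apply: cross E; [apply: lowt|lra].
- by move=> /esym E; exfalso; apply: cross E; [apply: lowt|lra].
by move=> /gI; rewrite !in_itv /= => /(_ ltac:(lra) ltac:(lra)); lra.
Qed.

End LocallyAffineLoops.

(** * The random knot *)

Section BoundaryCurve.
Context {R : realType}.

Lemma clamp_double (v : R) : 0 <= v <= 1 -> 2 * v = clamp (2 * v) + clamp (2 * v - 1).
Proof.
move=> v01; have [v2|v2] := leP v 2^-1.
  by rewrite (@clamp_id _ (2 * v)) ?(@clamp0 _ (2 * v - 1)); lra.
by rewrite (@clamp1 _ (2 * v)) ?(@clamp_id _ (2 * v - 1)); lra.
Qed.

Variable N : nat.
Hypothesis N0 : (0 < N)%N.

Let corner : 'rV[R]_3 := N%:R *: delta_mx 0 axis1 + 3^-1 *: delta_mx 0 axis3.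
Let a : 'rV[R]_3 := centre (triangle_f N).
Let b : 'rV[R]_3 := centre (triangle_f' N).
(* From f straight to (N, 0, 1/3) in the side x_2 = 0, then to f' in the side x_1 = N. *)
Let bent t : 'rV[R]_3 := a + clamp (2 * t) *: (corner - a) + clamp (2 * t - 1) *: (b - corner).

Let aE : [/\ a ord0 axis1 = 2 / 3, a ord0 axis2 = 0 & a ord0 axis3 = 3^-1].
Proof.
have [x xs] := start_face_ex N0; rewrite /a (start_face_centre N0 xs).
by move: xs => /and3P[/eqP x1 /eqP x2 /eqP x3]; rewrite !mxE x1 x2 x3; split; lra.
Qed.

Let bE : [/\ b ord0 axis1 = N%:R, b ord0 axis2 = N%:R - 2 / 3 & b ord0 axis3 = N%:R - 3^-1].
Proof.
have [x xs] := end_face_ex N0; rewrite /b (end_face_centre N0 xs).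
move: xs => /and3P[/eqP x1 /eqP x2 /eqP x3].
have y1 : (bary x axis1)%:R = 3 * N%:R :> R by rewrite x1 natrM.
have y2 : (bary x axis2)%:R + 2 = 3 * N%:R :> R by rewrite -natrD addn2 x2 natrM.
have y3 : (bary x axis3)%:R + 1 = 3 * N%:R :> R by rewrite natr1 x3 natrM.
by rewrite !mxE; split; lra.
Qed.

Let cornerE : [/\ corner ord0 axis1 = N%:R, corner ord0 axis2 = 0 & corner ord0 axis3 = 3^-1].
Proof. by rewrite !mxE !axis_eqE !eqxx /= !mulr0 !mulr1 addr0 !add0r. Qed.

Let bent_low t : t <= 2^-1 -> bent t = a + clamp (2 * t) *: (corner - a).
Proof. by move=> t2; rewrite /bent (@clamp0 _ (_ - 1)) ?scale0r ?addr0 //; lra. Qed.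

Let bent_high t : 2^-1 <= t -> bent t = corner + clamp (2 * t - 1) *: (b - corner).
Proof. by move=> t2; rewrite /bent clamp1 ?scale1r 1?(addrC a) ?subrK //; lra. Qed.

Lemma boundary_curve_ex : exists gamma : R -> 'rV[R]_3, boundary_curve N gamma.
Proof.
have N1 : 1 <= N%:R :> R by rewrite ler1n.
have [a1 a2 a3] := aE; have [b1 b2 b3] := bE; have [c1 c2 c3] := cornerE.
have coord (x y : 'rV[R]_3) t i : (x + t *: (y - x)) ord0 i = x ord0 i + t * (y ord0 i - x ord0 i).
  by rewrite !mxE.
have coord3 t i : (bent t) ord0 i = a ord0 i + clamp (2 * t) * (corner ord0 i - a ord0 i)
    + clamp (2 * t - 1) * (b ord0 i - corner ord0 i).
  have gen (x y z : 'rV[R]_3) (u v : R) : (x + u *: (y - x) + v *: (z - y)) ord0 i =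
      x ord0 i + u * (y ord0 i - x ord0 i) + v * (z ord0 i - y ord0 i) by rewrite !mxE.
  exact: gen.
have between (x y t : R) : 0 <= x <= N%:R -> 0 <= y <= N%:R -> 0 <= t <= 1 ->
    0 <= x + t * (y - x) <= N%:R.
  move=> /andP[x0 xN] /andP[y0 yN] /andP[t0 t1].
  have -> : x + t * (y - x) = (1 - t) * x + t * y by ring.
  have := ler_wpM2l t0 yN; have t1' : 0 <= 1 - t by lra.
  have := ler_wpM2l t1' xN; have := mulr_ge0 t0 y0; have := mulr_ge0 t1' x0; lra.
exists bent; split.
- exists [:: 0; 2^-1; 1]; split=> //=.
    by rewrite andbT; apply/andP; lra.
  move=> [|[|//]] _ s; rewrite in_itv /= => /andP[s0 s1].
    rewrite !bent_low ?invr_ge0 ?mulr0 ?add0r; [|lra..].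
    rewrite !clamp_id; [|lra..].
    by apply/rowP => i; rewrite !mxE; field.
  rewrite !bent_high ?invr_ge0; [|lra..].
  rewrite !clamp_id; [|lra..].
  by apply/rowP => i; rewrite !mxE; field.
- move=> t u; rewrite !in_itv /= => t01 u01 /rowP E.
  (* Only the second leg moves the second coordinate and only the first leg moves the first one,
     both with slope [N - 2/3]. They determine the two clamps, and [clamp_double] recovers the
     time. *)
  have := E axis1; have := E axis2; rewrite !coord3 a1 a2 b1 b2 c1 c2 subrr !mulr0 !addr0 !subr0.
  have N23 : N%:R - 2 / 3 != 0 :> R by rewrite subr_eq0; apply/eqP; lra.
  move=> /addrI/(mulIf N23) Y; rewrite Y => /addIr/addrI/(mulIf N23) X.
  by have := clamp_double t01; rewrite X Y -clamp_double // => /mulfI; apply; rewrite pnatr_eq0.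
- move=> t; rewrite in_itv /= => t01.
  have range (z : 'rV[R]_3) (z1 z2 z3 : R) :
      [/\ z ord0 axis1 = z1, z ord0 axis2 = z2 & z ord0 axis3 = z3] ->
      0 <= z1 <= N%:R -> 0 <= z2 <= N%:R -> 0 <= z3 <= N%:R ->
      forall i, 0 <= z ord0 i <= N%:R.
    by move=> [<- <- <-] ? ? ?; apply: axis_ind.
  have ra := range _ _ _ _ aE ltac:(lra) ltac:(lra) ltac:(lra).
  have rb := range _ _ _ _ bE ltac:(lra) ltac:(lra) ltac:(lra).
  have rc := range _ _ _ _ cornerE ltac:(lra) ltac:(lra) ltac:(lra).
  have cl01 v : 0 <= clamp v <= 1 by have := clamp_itv v; rewrite in_itv.
  have [t2|/ltW t2] := leP t 2^-1.
    rewrite bent_low //; apply: (cube_boundaryI (i := axis2)) => [i|].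
      by rewrite coord; apply: between.
    by left; rewrite coord a2 c2 subrr mulr0 addr0.
  rewrite bent_high //; apply: (cube_boundaryI (i := axis1)) => [i|].
    by rewrite coord; apply: between.
  by right; rewrite coord b1 c1 subrr mulr0 addr0.
- by rewrite bent_low ?invr_ge0 // mulr0 clamp0 // scale0r addr0.
rewrite bent_high; last by lra.
by rewrite clamp1 ?scale1r 1?addrC ?subrK //; lra.
Qed.

End BoundaryCurve.

Lemma ae_dobrushin_boundary (R : realType) (N : nat) (d : measure_display)
    (T : measurableType d) (P : probability T R) (U : site N -> T -> 'I_3) :
  (0 < N)%N -> dobrushin_percolation P U ->
  {ae P, forall w, dobrushin_boundary (fun x => U x w)}.
Proof.
move=> N0 [_ _ _ [U0 U1 U2]].
have all_sites : {ae P, forall w, forall x : site N, on_boundary x ->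
    U x w = dobrushin_colour N (x axis1) (x axis2) (x axis3) :> nat}.
  (* Finitely many sites, so the exceptional null sets can be merged. *)
  apply: filter_forall => x; have [xb|xb] := boolP (on_boundary x); last first.
    exact: aeW.
  have [[-> bx]|[-> bx]|[-> bx]] := dobrushin_colourP N0 xb.
  - by apply: filterS (U0 x bx) => w -> _; rewrite inordK.
  - by apply: filterS (U1 x bx) => w -> _; rewrite inordK.
  - by apply: filterS (U2 x bx) => w -> _; rewrite inordK.
exact: all_sites.
Qed.

Lemma closed_line_unknot (R : realType) (N : nat) (N0 : (0 < N)%N) (col : site N -> 'I_3) :
  dobrushin_boundary col -> exists Gamma : seq 'rV[R]_3,
    unique (line_from_f_to_f' col) Gamma /\
    forall gamma : R -> 'rV[R]_3, boundary_curve N gamma ->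
      simple_loop (close_with Gamma gamma) /\ knot_equiv (close_with Gamma gamma) std_quad.
Proof.
move=> colD; have [L [L0 eL wB wT]] := walk_ends N0 colD.
exists (line col N0 L); split; first exact: walk_line.
have lineE : (size (line (R := R) col N0 L)).-1 = L by rewrite size_mkseq.
move=> gamma [gpa gI gb g0 g1]; apply: (@close_with_unknot _ N) => //.
- by rewrite size_mkseq.
- by rewrite line_nth // g0 (start_face_centre N0 (start_walk col N0)).
- by rewrite -nth_last lineE line_nth // g1 (end_face_centre N0 eL).
- by rewrite lineE => t u; apply: line_inj.
by rewrite lineE => t a; apply: line_inside.
Qed.

Unset Implicit Arguments.

Theorem proposition1p2 (R : realType) (N : nat) (N_ge1 : (1 <= N)%N)
    (d : measure_display) (T : measurableType d) (P : probability T R)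
    (U : site N -> T -> colour) (UD : dobrushin_percolation P U) :
  (exists gamma : R -> 'rV[R]_3, boundary_curve N gamma) /\
  exists K : T -> knot R,
    random_knot K /\
    {ae P, forall w, exists Gamma : seq 'rV[R]_3,
       unique (line_from_f_to_f' (fun x => U x w)) Gamma /\
       forall gamma : R -> 'rV[R]_3, boundary_curve N gamma ->
         simple_loop (close_with Gamma gamma) /\
         knot_set (K w) = knot_class (close_with Gamma gamma)}.
Proof.
split; first exact: boundary_curve_ex.
have std_knotP : exists2 g : R -> 'rV[R]_3, simple_loop g & knot_class std_quad = knot_class g.
  by exists std_quad => //; apply: quad_simple; apply: basis_indep2; rewrite axis_eqE.
pose K0 := Knot std_knotP.
(* Preimages under a constant map are empty or everything, hence measurable. *)
exists (fun=> K0); split.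
  move=> A; have [AK|nAK] := pselect (A K0).
    rewrite (_ : _ @^-1` A = setT); first exact: measurableT.
    by apply/seteqP; split.
  rewrite (_ : _ @^-1` A = set0); first exact: measurable0.
  by apply/seteqP; split.
apply: filterS (ae_dobrushin_boundary N_ge1 UD) => w /(@closed_line_unknot R N N_ge1).
move=> [Gamma [GammaU closed]]; exists Gamma; split=> // gamma /closed[simple std].
by split=> //; apply: knot_class_eq; apply: knot_equiv_sym.
Qed.
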